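(* Fix $(\alpha,\beta,\theta)\in(0,1)^3$ such that $\alpha<\eta^{hyp}_\theta(\beta)$. Consider testing $H_0^{(p)}$: $X_i\stackrel{iid}{\sim}N(0,I_p)$, $1\le i\le n$, against $H_1^{(p)}$: the $X_i$'s are generated from the ARW model with parameters $(\alpha,\beta,\theta)$. As $p\to\infty$: (i) $\mathrm{Err}(\hat T^{(sa)}_*,\alpha,\beta,\theta)\to0$ if $\alpha<\eta^{hyp,1}_\theta(\beta)$; (ii) $\mathrm{Err}(\hat T^{(sa)}_N,\alpha,\beta,\theta)\to0$ if $\alpha<\eta^{hyp,2}_\theta(\beta)$ and we take $N=\lceil p\epsilon_p\rceil$.
   Context: ARW model. For each $p$ let $n=n_p=p^\theta$ (treated as an integer), $\epsilon_p=p^{-\beta}$, $\tau_p=p^{-\alpha}$. The labels $\ell_1,\dots,\ell_n$ are i.i.d. uniform on $\{-1,1\}$; the coordinates of $\mu\in\mathbb R^p$ are i.i.d., equal to $\tau_p$ with probability $\epsilon_p$ and to $0$ with probability $1-\epsilon_p$; $Z_1,\dots,Z_n$ are i.i.d. $N(0,I_p)$; all are independent; $X_i=\ell_i\mu+Z_i$, $1\le i\le n$, are the rows of $X=[x_1,\dots,x_p]\in\mathbb R^{n\times p}$ (columns $x_j$). Testing error. $\mathrm{Err}(\hat T,\alpha,\beta,\theta)=P_{H_0^{(p)}}(\hat T\text{ rejects }H_0^{(p)})+P_{H_1^{(p)}}(\hat T\text{ accepts }H_0^{(p)})$, with probabilities over $(\ell,\mu,Z)$. Tests. $\hat T^{(sa)}_*$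 rejects $H_0^{(p)}$ iff $(2n)^{-1/2}[p\|\bar x\|^2-n]\ge2\sqrt{2\log p}$, where $\bar x=p^{-1}\sum_{j=1}^px_j$. $\hat T^{(sa)}_N$ rejects $H_0^{(p)}$ iff $N^{-1/2}\|\sum_{j\in\hat S^{(sa)}_N}x_j\|_1\ge\sqrt{2/\pi}\,n+\sqrt{2n(N+2)\log p}$, where $\hat S^{(sa)}_N$ is a maximizer of $N^{-1/2}\|\sum_{j\in S}x_j\|_1$ over $S\subset\{1,\dots,p\}$ with $|S|=N$. Curves: $\eta^{hyp}_\theta(\beta)=\max\{\eta^{hyp,1}_\theta(\beta),\eta^{hyp,2}_\theta(\beta)\}$ with $\eta^{hyp,1}_\theta(\beta)=(2+\theta-4\beta)/4$ and $\eta^{hyp,2}_\theta(\beta)=\min\{\theta/2,(1+\theta-\beta)/4\}$. *)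

(* Defs.v *)
From HB Require Import structures.
From mathcomp Require Import all_boot all_order all_algebra.
From mathcomp Require Import all_classical all_reals all_analysis.

Set Implicit Arguments.
Unset Strict Implicit.
Unset Printing Implicit Defensive.

Import Order.TTheory GRing.Theory Num.Theory.
Import numFieldNormedType.Exports.

Local Open Scope classical_set_scope.
Local Open Scope ring_scope.

Section Probability.
Context {R : realType} {d : measure_display} {T : measurableType d}.
Variable P : probability T R.

(* The events [B i] may be taken equal to [setT], so the product rule over the
   whole finite index type contains the product rule over every subfamily. *)
Definition mutually_independent (I : finType) (X : I -> {RV P >-> R}) : Prop :=
  forall B : I -> set R, (forall i, measurable (B i)) ->
    P (\bigcap_(i in [set: I]) (X i @^-1` B i)) = (\prod_i P (X i @^-1` B i))%E.

Definition has_two_point_law (w a b : R) (X : {RV P >-> R}) : Prop :=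
  forall A : set R, measurable A ->
    distribution P X A = (w%:E * \d_a A + (1 - w)%:E * \d_b A)%E.

Definition has_std_normal_law (X : {RV P >-> R}) : Prop :=
  forall A : set R, measurable A -> distribution P X A = normal_prob 0 1 A.

End Probability.

Section Model.
Context {R : realType}.

Definition eps (beta : R) (p : nat) : R := p%:R `^ (- beta).
Definition tau (alpha : R) (p : nat) : R := p%:R `^ (- alpha).

(* Rows i.i.d. [N(0, I_p)]: since [N(0, I_p)] is the law of a vector of [p]
   independent standard normals, this says that all [n * p] entries are
   independent standard normals. *)
Definition null_model {d : measure_display} {T : measurableType d}
    (P : probability T R) (n p : nat) (X : T -> 'M[R]_(n, p)) : Prop :=
  exists Z : 'I_n * 'I_p -> {RV P >-> R},
    [/\ mutually_independent Z,
        forall ij, has_std_normal_law (Z ij)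
      & forall w, X w = \matrix_(i, j) Z (i, j) w].

Definition ARW_family {d : measure_display} {T : measurableType d}
    (P : probability T R) (n p : nat)
    (ell : 'I_n -> {RV P >-> R}) (mu : 'I_p -> {RV P >-> R})
    (Z : 'I_n * 'I_p -> {RV P >-> R}) :
    ('I_n + 'I_p + 'I_n * 'I_p)%type -> {RV P >-> R} :=
  fun k => match k with
           | inl (inl i) => ell i
           | inl (inr j) => mu j
           | inr ij => Z ij
           end.

Definition ARW_model {d : measure_display} {T : measurableType d}
    (alpha beta : R) (P : probability T R) (n p : nat)
    (X : T -> 'M[R]_(n, p)) : Prop :=
  exists (ell : 'I_n -> {RV P >-> R}) (mu : 'I_p -> {RV P >-> R})
         (Z : 'I_n * 'I_p -> {RV P >-> R}),
    [/\ mutually_independent (ARW_family ell mu Z),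
        forall i, has_two_point_law (2^-1) 1 (-1) (ell i),
        forall j, has_two_point_law (eps beta p) (tau alpha p) 0 (mu j),
        forall ij, has_std_normal_law (Z ij)
      & forall w, X w = \matrix_(i, j) (ell i w * mu j w + Z (i, j) w)].

Definition norm1 (n : nat) (v : 'cV[R]_n) : R := \sum_i `|v i 0|.
Definition norm2 (n : nat) (v : 'cV[R]_n) : R := Num.sqrt (\sum_i v i 0 ^+ 2).

(* A test maps the data matrix to [true] when it rejects the null hypothesis. *)

Definition xbar (n p : nat) (X : 'M[R]_(n, p)) : 'cV[R]_n :=
  p%:R^-1 *: \sum_j col j X.

Definition T_star (n p : nat) (X : 'M[R]_(n, p)) : bool :=
  2 * Num.sqrt (2 * ln p%:R) <=
  (Num.sqrt (2 * n%:R))^-1 * (p%:R * norm2 (xbar X) ^+ 2 - n%:R).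

Definition sa_stat (n p N : nat) (X : 'M[R]_(n, p)) (S : {set 'I_p}) : R :=
  (Num.sqrt N%:R)^-1 * norm1 (\sum_(j in S) col j X).

Definition sa_maximizer (n p N : nat) (X : 'M[R]_(n, p)) (S : {set 'I_p}) :
    Prop :=
  #|S| = N /\
  forall S' : {set 'I_p}, #|S'| = N -> sa_stat N X S' <= sa_stat N X S.

Definition T_sa (n p N : nat) (Shat : 'M[R]_(n, p) -> {set 'I_p})
    (X : 'M[R]_(n, p)) : bool :=
  Num.sqrt (2 / pi) * n%:R + Num.sqrt (2 * n%:R * (N%:R + 2) * ln p%:R) <=
  sa_stat N X (Shat X).

(* [X0] and [X1] are the data under the null and the alternative; they need
   not live on the same probability space. *)
Definition Err {d0 d1 : measure_display}
    {T0 : measurableType d0} {T1 : measurableType d1}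
    (P0 : probability T0 R) (P1 : probability T1 R) (n p : nat)
    (X0 : T0 -> 'M[R]_(n, p)) (X1 : T1 -> 'M[R]_(n, p))
    (test : 'M[R]_(n, p) -> bool) : \bar R :=
  (P0 [set w | test (X0 w)] + P1 [set w | ~~ test (X1 w)])%E.

Definition eta_hyp1 (theta beta : R) : R := (2 + theta - 4 * beta) / 4.
Definition eta_hyp2 (theta beta : R) : R :=
  Num.min (theta / 2) ((1 + theta - beta) / 4).
Definition eta_hyp (theta beta : R) : R :=
  Num.max (eta_hyp1 theta beta) (eta_hyp2 theta beta).

(* [`|Num.ceil _|%N] only casts the (nonnegative) integer to [nat]. *)
Definition N_sa (beta : R) (p : nat) : nat :=
  `|Num.ceil (p%:R * eps beta p)|%N.

End Model.

(* Main.v *)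
(** Both tests are controlled by exponential moments alone. For a fixed set of
    columns the normalized row sums of the noise are i.i.d. N(0,1), so every
    error probability reduces to a Chernoff bound for [\sum_i g(Y_i)] with
    [g] a square or an absolute value. Under the null the scan statistic is
    handled by a union bound over the [binom(p, N) <= p^N] sets, which the term
    [(N + 2) log p] of the threshold absorbs. Under the alternative one
    conditions on the signs and on the support of [mu], which has at least
    [p eps / 4] elements outside an event of exponentially small probability;
    given these, the [i]-th row sum is [+-m + Y_i] with a common shift [m],
    where [m] is about [sqrt p * tau * eps] for all columns and at least a
    constant times [tau * sqrt (p eps)] for a set of [N] columns chosen to
    contain or to be contained in the support. The tests succeed because
    [E (m + Y)^2] exceeds 1 by [m^2] and [E |m + Y|] exceeds [sqrt (2 / pi)]
    by at least a constant times [m * min(m, 1)]. *)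

(* The curves come from comparing signal and fluctuation. For all columns, [m^2] is about
   [p tau^2 eps^2], and [sqrt n * m^2] must beat [sqrt (log p)]: this is
   [theta + 2 - 4 alpha - 4 beta > 0]. For [N] columns the gain of E |m + Y| is linear in [m] above
   1 and quadratic below 1; asking that [n * gain^2] beat [N log p] gives [alpha < theta / 2] in the
   first regime and [alpha < (1 + theta - beta) / 4] in the second, hence the minimum of the two.
   Conditioning requires no conditional expectation: signs and support together take finitely many
   values and are independent of the noise, so it becomes a finite sum over fibers. The laws fix the
   values of the signs and of [mu] only almost surely, so null events are split off first. The scan
   maximum is bounded below by its value at a single set that depends on the support but not on the
   noise, so the row sums over this set stay Gaussian. *)
From HB Require Import structures.
Require Import Defs.
From mathcomp Require Import all_boot all_order all_algebra.
From mathcomp Require Import all_classical all_reals all_analysis.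
From mathcomp Require Import measurable_realfun ring lra.
Import Order.TTheory GRing.Theory Num.Theory.
Import numFieldNormedType.Exports.
Local Open Scope classical_set_scope.
Local Open Scope ring_scope.

Set Implicit Arguments.
Unset Strict Implicit.
Unset Printing Implicit Defensive.

(** * Gaussian integrals *)

(* The canonical measure structure of [pushforward] takes the measurability
   proof as an argument that unification cannot find. *)
Definition image_measure {d d' : measure_display} {T1 : measurableType d}
    {T2 : measurableType d'} {R : realType} (m : {measure set T1 -> \bar R})
    (f : T1 -> T2) (mf : measurable_fun [set: T1] f) :
    {measure set T2 -> \bar R} :=
  measure_function_pushforward__canonical__measure_function_Measure m mf.

Section NormalAffine.
Context {R : realType}.
Local Notation mu := (@lebesgue_measure R).
Implicit Types (m s t x : R).

(** The Radon-Nikodym derivative of [normal_prob m s] has the same integral as [normal_pdf m s] over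
    every measurable set, so the two agree almost everywhere. *)
Lemma integral_normal_prob m s (f : R -> \bar R) :
  measurable_fun [set: R] f -> (forall x, 0 <= f x)%E ->
  (\int[normal_prob m s]_x f x = \int[mu]_x (f x * (normal_pdf m s x)%:E))%E.
Proof.
move=> mf f0.
have dom := @normal_prob_dominates R m s.
rewrite -(Radon_Nikodym_SigmaFinite.change_of_variables dom f0 measurableT mf).
apply: ge0_ae_eq_integral => //=.
- apply: emeasurable_funM => //.
  exact: measurable_int (Radon_Nikodym_SigmaFinite.f_integrable dom).
- apply: emeasurable_funM => //; apply/measurable_EFinP.
  exact: measurable_normal_pdf.
- by move=> x _; rewrite mule_ge0// Radon_Nikodym_SigmaFinite.f_ge0.
- by move=> x _; rewrite mule_ge0// lee_fin normal_pdf_ge0.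
- apply: ae_eqe_mul2l.
  apply: integral_ae_eq => //=.
  + exact: Radon_Nikodym_SigmaFinite.f_integrable.
  + by apply/measurable_EFinP; exact: measurable_normal_pdf.
  + by move=> E _ mE; rewrite -Radon_Nikodym_SigmaFinite.f_integral.
Qed.

(** Uniqueness of Lebesgue measure: [s] times the image measure gives half-open intervals their
    length. *)
Lemma lebesgue_measure_affine m s (s0 : 0 < s) (A : set R) : measurable A ->
  mu ((fun x => m + s * x) @^-1` A) = ((s^-1)%:E * mu A)%E.
Proof.
move=> mA.
have mphi : measurable_fun setT (fun x : measurableTypeR R => m + s * x : measurableTypeR R).
  by apply: measurable_funD => //; exact: measurable_funM.
pose k := NngNum (ltW s0).
pose nu := mscale k (image_measure mu mphi).
have : mu A = nu A.
  apply: lebesgue_measure_unique => //= _ [[a b]] _ <-.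
  rewrite /nu /mscale /= /pushforward.
  have -> : (fun x => m + s * x) @^-1` `]a, b] = `](a - m) / s, (b - m) / s]%classic.
    apply/seteqP; split => x /=; rewrite !in_itv/= ltr_pdivrMr// ler_pdivlMr//;
      move=> /andP[h1 h2]; apply/andP; split; lra.
  rewrite !lebesgue_measure_itv/= !lte_fin ltr_pM2r ?invr_gt0// ltrD2r.
  case: ifPn => ab; last by rewrite mule0.
  rewrite -!EFinB -EFinM; congr EFin; field.
  by rewrite gt_eqF.
move=> ->; rewrite /nu /mscale /= /pushforward muleA -EFinM mulVf ?gt_eqF//.
by rewrite mul1e.
Qed.

Lemma integral_lebesgue_affine m s (s0 : 0 < s) (f : R -> \bar R) :
  measurable_fun [set: R] f -> (forall x, 0 <= f x)%E ->
  (\int[mu]_x f (m + s * x)%R = (s^-1)%:E * \int[mu]_x f x)%E.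
Proof.
move=> mf f0.
have mphi : measurable_fun setT (fun x : measurableTypeR R => m + s * x : measurableTypeR R).
  by apply: measurable_funD => //; exact: measurable_funM.
have si0 : 0 <= s^-1 by rewrite invr_ge0 ltW.
rewrite -[LHS](@ge0_integral_pushforward _ _ _ _ _ _ mphi mu setT f)//.
rewrite -(@ge0_integral_mscale _ _ R mu _ measurableT (NngNum si0))//.
apply: eq_measure_integral => //= A mA _.
by rewrite /pushforward /mscale /= lebesgue_measure_affine.
Qed.

Lemma integral_normal_affine m s (s0 : 0 < s) (f : R -> \bar R) :
  measurable_fun [set: R] f -> (forall x, 0 <= f x)%E ->
  (\int[normal_prob 0 1]_x f (m + s * x)%R = \int[normal_prob m s]_x f x)%E.
Proof.
move=> mf f0.
have mphi : measurable_fun setT (fun x : measurableTypeR R => m + s * x : measurableTypeR R).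
  by apply: measurable_funD => //; exact: measurable_funM.
have nz : s != 0 by rewrite gt_eqF.
rewrite integral_normal_prob//; last exact: measurableT_comp.
rewrite [RHS](integral_normal_prob m s mf f0).
(* The factor [s] cancels the Jacobian [s^-1] of the substitution. *)
pose g y := (f y * (s * normal_pdf m s y)%:E)%E.
transitivity (\int[mu]_x g (m + s * x)%R)%E.
  apply: eq_integral => x _ /=; rewrite /g; congr (_ * _%:E)%E.
  rewrite !normal_pdfE ?oner_eq0// /normal_peak /normal_fun.
  rewrite mulrA; congr (_ * expR _).
    rewrite expr1n mul1r -mulrnAr sqrtrM ?sqr_ge0// sqrtr_sqr gtr0_norm//.
    by rewrite invfM mulrA mulfV// mul1r.
  by field.
rewrite (integral_lebesgue_affine m s0 (f := g)); last 2 first.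
- apply: emeasurable_funM => //; apply/measurable_EFinP.
  by apply: measurable_funM => //; exact: measurable_normal_pdf.
- by move=> x; rewrite mule_ge0// lee_fin mulr_ge0 ?normal_pdf_ge0// ltW.
rewrite -ge0_integralZl//; last 3 first.
- apply: emeasurable_funM => //; apply/measurable_EFinP.
  by apply: measurable_funM => //; exact: measurable_normal_pdf.
- by move=> x _; rewrite mule_ge0// lee_fin mulr_ge0 ?normal_pdf_ge0// ltW.
- by rewrite lee_fin invr_ge0 ltW.
apply: eq_integral => x _; rewrite muleCA -EFinM mulrA mulVf// mul1r//.
Qed.
End NormalAffine.

(** * Symmetry and convolution of normal laws *)

Section NormalConvolution.
Context {R : realType}.
Local Notation mu := (@lebesgue_measure R).
Local Notation gam := (@normal_prob R 0 1).
Implicit Types (m s t x : R).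

Lemma integral_std_normalN (f : R -> \bar R) :
  measurable_fun [set: R] f -> (forall x, 0 <= f x)%E ->
  (\int[gam]_x f (- x)%R = \int[gam]_x f x)%E.
Proof.
move=> mf f0.
have mopp : measurable_fun [set: measurableTypeR R]
    (fun x : measurableTypeR R => - x : measurableTypeR R).
  exact: oppr_measurable.
rewrite integral_normal_prob//; last exact: measurableT_comp.
rewrite [RHS](integral_normal_prob 0 1 mf f0).
pose g y := (f y * (normal_pdf 0 1 y)%:E)%E.
have g0 x : (0 <= g x)%E by rewrite mule_ge0// lee_fin normal_pdf_ge0.
have mg : measurable_fun [set: R] g.
  apply: emeasurable_funM => //; apply/measurable_EFinP.
  exact: measurable_normal_pdf.
transitivity (\int[mu]_x g (- x)%R)%E.
  apply: eq_integral => x _ /=; rewrite /g; congr (_ * _%:E)%E.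
  by rewrite !normal_pdfE ?oner_eq0// /normal_fun !subr0 sqrrN.
rewrite -[LHS](@ge0_integral_pushforward _ _ _ _ _ _ mopp mu setT g)//.
by apply: eq_measure_integral => //= A mA _; exact: lebesgue_measureN.
Qed.

Lemma normal_peakE s : 0 < s -> normal_peak s = (s * Num.sqrt (pi *+ 2))^-1.
Proof.
by move=> s0; rewrite /normal_peak -mulrnAr sqrtrM ?sqr_ge0// sqrtr_sqr gtr0_norm.
Qed.

(** This is the inductive step for sums of independent normals. The case [a = 0] is allowed because
    that induction starts from the empty sum. *)
Lemma integral_std_normal_conv (a b : R) (f : R -> \bar R) : 0 <= a -> 0 < b ->
  measurable_fun [set: R] f -> (forall x, 0 <= f x)%E ->
  (\int[gam]_x \int[gam]_y f (a * x + b * y)%R =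
   \int[gam]_z f (Num.sqrt (a ^+ 2 + b ^+ 2) * z)%R)%E.
Proof.
move=> a0 b0 mf f0.
set c := Num.sqrt _.
have c2 : c ^+ 2 = a ^+ 2 + b ^+ 2.
  by rewrite sqr_sqrtr// addr_ge0// sqr_ge0.
have c0 : 0 < c by rewrite sqrtr_gt0 ltr_wpDl ?sqr_ge0// exprn_gt0.
have cn0 : c != 0 by rewrite gt_eqF.
have bn0 : b != 0 by rewrite gt_eqF.
have an0 : a ^+ 2 + b ^+ 2 != 0 by rewrite -c2 expf_neq0.
have bc0 : b / c != 0 by rewrite mulf_neq0// invr_neq0.
pose h u x := normal_pdf (a * x) b u * normal_pdf 0 1 x.
(* The joint density of the sum and of x, factored as marginal times conditional. *)
have hE u x : h u x = normal_pdf 0 c u * normal_pdf (a * u / c ^+ 2) (b / c) x.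
  rewrite /h !normal_pdfE ?oner_eq0//.
  rewrite mulrACA [RHS]mulrACA; congr (_ * _).
    rewrite !normal_peakE ?divr_gt0//; field.
    by rewrite bn0 cn0 gt_eqF// sqrtr_gt0 pmulrn_lgt0// pi_gt0.
  rewrite /normal_fun -!expRD; congr expR.
  rewrite expr_div_n c2; field.
  by rewrite an0 bn0.
have pdfB m x : normal_pdf m b x = normal_pdf 0 b (x - m).
  by rewrite !normal_pdfE//= /normal_fun subr0.
have mpdf : measurable_fun [set: R * R]
    (fun z : R * R => normal_pdf (a * z.1) b z.2).
  under eq_fun do rewrite pdfB.
  apply: (@measurableT_comp _ _ _ _ _ _ (normal_pdf 0 b)) => //.
    exact: measurable_normal_pdf.
  by apply: measurable_funB => //; exact: measurable_funM.
have mfz : measurable_fun [set: R * R] (fun z : R * R => f z.2).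
  exact: measurableT_comp.
have mh : measurable_fun [set: R * R] (fun z : R * R => h z.2 z.1).
  apply: measurable_funM => //.
  apply: (@measurableT_comp _ _ _ _ _ _ (normal_pdf 0 1)) => //.
  exact: measurable_normal_pdf.
transitivity (\int[gam]_x \int[mu]_u (f u * (normal_pdf (a * x) b u)%:E))%E.
  apply: eq_integral => x _.
  by rewrite integral_normal_affine// integral_normal_prob.
rewrite integral_normal_prob; last 2 first.
- apply: (@measurable_fun_fubini_tonelli_F _ _ _ _ R mu
    (fun z : R * R => f z.2 * (normal_pdf (a * z.1) b z.2)%:E)%E).
  + by apply: emeasurable_funM => //; exact/measurable_EFinP.
  + by move=> z; rewrite mule_ge0// lee_fin normal_pdf_ge0.
- by move=> x; apply: integral_ge0 => u _; rewrite mule_ge0// lee_fin normal_pdf_ge0.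
transitivity (\int[mu]_x \int[mu]_u (f u * (h u x)%:E))%E.
  apply: eq_integral => x _; rewrite -ge0_integralZr//.
  - by apply: eq_integral => u _; rewrite -muleA -EFinM.
  - apply: emeasurable_funM => //; apply/measurable_EFinP.
    exact: measurable_normal_pdf.
  - by move=> u _; rewrite mule_ge0// lee_fin normal_pdf_ge0.
  - by rewrite lee_fin normal_pdf_ge0.
rewrite (@fubini_tonelli _ _ _ _ R mu mu (fun z => f z.2 * (h z.2 z.1)%:E)%E)/=; last 2 first.
- by apply: emeasurable_funM => //; exact/measurable_EFinP.
- by move=> z; rewrite mule_ge0// lee_fin mulr_ge0// normal_pdf_ge0.
transitivity (\int[gam]_z f (0 + c * z)%R)%E; last first.
  by under eq_integral do rewrite add0r.
rewrite (integral_normal_affine 0 c0)// integral_normal_prob//.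
apply: eq_integral => u _.
under eq_integral do rewrite hE EFinM muleA.
rewrite ge0_integralZl//.
- by rewrite integral_normal_pdf mule1.
- by apply/measurable_EFinP; exact: measurable_normal_pdf.
- by move=> x _; rewrite lee_fin normal_pdf_ge0.
- by rewrite mule_ge0// lee_fin normal_pdf_ge0.
Qed.
End NormalConvolution.

(** * Exponential moments of squares of shifted normals *)

Section GaussSquares.
Context {R : realType}.
Local Notation mu := (@lebesgue_measure R).
Local Notation gam := (@normal_prob R 0 1).
Local Notation b := (Num.sqrt (2 / pi) : R).
Implicit Types (m s t x : R).

Lemma normal_peak1E : normal_peak 1 = b / 2.
Proof.
rewrite normal_peakE// mul1r; have p0 := @pi_gt0 R.
have q0 : 0 < 2 / pi :> R by rewrite divr_gt0.
have -> : pi *+ 2 = (2 / pi)^-1 * 2 ^+ 2 :> R.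
  by rewrite invf_div expr2 mulrA divfK// mulr_natr.
move: q0; set q := 2 / pi => q0.
rewrite sqrtrM ?invr_ge0 ?ltW// sqrtrV ?ltW//.
by rewrite sqrtr_sqr ger0_norm// invfM invrK.
Qed.

(** Completing the square turns the integrand into a multiple of the normal density with mean [c]
    and variance [1 / (1 + 2t)]. Negative [t > -1/2] is allowed, which also yields the moment
    generating function of the square. *)
Lemma integral_exp_sqr_shift t m : 0 < 1 + 2 * t ->
  (\int[gam]_x (expR (- t * (m + x) ^+ 2))%:E =
   ((Num.sqrt (1 + 2 * t))^-1 * expR (- (t * m ^+ 2 / (1 + 2 * t))))%:E)%E.
Proof.
move=> t0; have tn0 : 1 + 2 * t != 0 by rewrite gt_eqF.
set s := (Num.sqrt _)^-1.
have s0 : 0 < s by rewrite invr_gt0 sqrtr_gt0.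
have sn0 : s != 0 by rewrite gt_eqF.
have s2 : s ^+ 2 = (1 + 2 * t)^-1 by rewrite exprVn sqr_sqrtr// ltW.
have mf : measurable_fun [set: R] (fun x => (expR (- t * (m + x) ^+ 2))%:E).
  apply/measurable_EFinP; apply: measurableT_comp => //.
  apply: measurable_funM => //; apply: measurable_funX.
  exact: measurable_funD.
rewrite integral_normal_prob//.
set c := - (2 * t * m) / (1 + 2 * t).
transitivity (\int[mu]_x ((s * expR (- (t * m ^+ 2 / (1 + 2 * t))))%:E *
   (normal_pdf c s x)%:E))%E.
  apply: eq_integral => x _; rewrite -!EFinM; congr EFin.
  rewrite !normal_pdfE ?oner_eq0// !normal_peakE//.
  rewrite /normal_fun mulrCA [RHS]mulrACA; congr (_ * _).
    by field; rewrite sn0 gt_eqF// sqrtr_gt0 pmulrn_lgt0// pi_gt0.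
  rewrite -!expRD; congr expR.
  by rewrite s2 /c; field.
rewrite ge0_integralZl//.
- by rewrite integral_normal_pdf mule1.
- by apply/measurable_EFinP; exact: measurable_normal_pdf.
- by move=> x _; rewrite lee_fin normal_pdf_ge0.
- by rewrite lee_fin mulr_ge0 ?expR_ge0// ltW.
Qed.

(** With the square root removed, [1 + x <= expR x] suffices in both uses below. *)
Lemma inv_sqrt_le_expR y t : 0 < y -> 1 <= y * expR (2 * t) ->
  (Num.sqrt y)^-1 <= expR t.
Proof.
move=> y0 h.
have -> : expR t = Num.sqrt (expR (2 * t)).
  by rewrite [2 * t]mulrDl mul1r expRD -expr2 sqrtr_sqr ger0_norm// expR_ge0.
rewrite -sqrtrV ?(ltW y0)// ler_wsqrtr//.
by rewrite -[y^-1]mul1r ler_pdivrMr// mulrC.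
Qed.

Lemma gauss_mgf_sqr t : 0 <= t <= 4^-1 ->
  (\int[gam]_x (expR (t * x ^+ 2))%:E <= (expR (t + 4 * t ^+ 2))%:E)%E.
Proof.
move=> /andP[t0 t4].
have h : 0 < 1 + 2 * (- t) by lra.
have := integral_exp_sqr_shift 0 h.
under eq_integral do rewrite add0r opprK.
move=> ->; rewrite lee_fin expr0n/= mulr0 mul0r oppr0 expR0 mulr1.
apply: inv_sqrt_le_expR => //.
have := expR_ge1Dx (2 * (t + 4 * t ^+ 2)).
set e := expR _ => he.
(* The product equals [1 + 4 t^2 (1 - 4t)], which is where [t <= 1/4] enters. *)
have : 1 <= (1 + 2 * - t) * (1 + 2 * (t + 4 * t ^+ 2)) by nra.
by move=> /le_trans; apply; rewrite ler_pM2l.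
Qed.

Lemma gauss_laplace_sqr_shift t m : 0 <= t ->
  (\int[gam]_x (expR (- t * (m + x) ^+ 2))%:E <=
   (expR (- t + 2 * t ^+ 2 - t * m ^+ 2 / (1 + 2 * t)))%:E)%E.
Proof.
move=> t0; have h : 0 < 1 + 2 * t by lra.
rewrite integral_exp_sqr_shift// lee_fin expRD ler_pM2r ?expR_gt0//.
apply: inv_sqrt_le_expR => //.
rewrite -(@ler_pM2r _ (expR (- (2 * (- t + 2 * t ^+ 2))))) ?expR_gt0//.
rewrite -mulrA -expRD subrr expR0 mulr1 mul1r.
set y := 2 * _.
have := expR_ge1Dx y; rewrite -[y in expR y]opprK expRN.
have y1 : 0 < 1 + y by rewrite /y; nra.
move=> h2.
have e0 : 0 < expR (- y) by exact: expR_gt0.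
have h3 : expR (- y) * (1 + y) <= 1.
  by rewrite -[leRHS](mulfV (lt0r_neq0 e0)) ler_pM2l.
(* What remains is [1 <= (1 + 2t)(1 + y)]; since [1 + y = 1 - 2t + 4t^2], the product is the sum of
   cubes [1 + 8t^3]. *)
rewrite -(ler_pM2r y1) (le_trans h3)// /y; nra.
Qed.
End GaussSquares.

(** * Upper exponential moment of the absolute value of a normal *)

Section GaussAbsUpper.
Context {R : realType}.
Local Notation mu := (@lebesgue_measure R).
Local Notation gam := (@normal_prob R 0 1).
Local Notation b := (Num.sqrt (2 / pi) : R).
Implicit Types (m s t x : R).

Lemma measurable_indicR (D : set R) : measurable D ->
  measurable_fun [set: R] (fun x => (\1_D x : R)%:E).
Proof. by move=> mD; apply/measurable_EFinP; exact: measurable_indic. Qed.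

Lemma gauss_itv_le (a c : R) : a <= c -> (gam `[a, c] <= ((c - a) * (b / 2))%:E)%E.
Proof.
move=> ac; rewrite /normal_prob.
apply: (@le_trans _ _ (\int[mu]_(x in `[a, c]) (b / 2)%:E)%E).
  apply: ge0_le_integral => //=.
  - by move=> x _; rewrite lee_fin normal_pdf_ge0.
  - by apply/measurable_EFinP/measurable_funTS; exact: measurable_normal_pdf.
  - move=> x _; rewrite lee_fin -normal_peak1E.
    by apply: normal_pdf_ub; rewrite oner_eq0.
rewrite integral_cst//= lebesgue_measure_itv/= lte_fin.
case: ifPn => h; last by rewrite mule0 lee_fin mulr_ge0// ?subr_ge0// divr_ge0.
by rewrite -EFinB -EFinM mulrC.
Qed.

Lemma gauss_itv_ge (a : R) : 0 <= a -> a <= 1 ->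
  ((2 * a * normal_pdf 0 1 1)%:E <= gam `[(- a)%R, a])%E.
Proof.
move=> a0 a1; rewrite /normal_prob.
apply: (@le_trans _ _ (\int[mu]_(x in `[(- a)%R, a]) (normal_pdf 0 1 1 : R)%:E)%E).
  rewrite integral_cst//= lebesgue_measure_itv/= lte_fin.
  case: ifPn => h; last first.
    have -> : a = 0 by apply/eqP; rewrite eq_le a0 andbT; move: h; rewrite -leNgt; lra.
    by rewrite mulr0 mul0r mule0.
  by rewrite -EFinB -EFinM lee_fin opprK; lra.
apply: ge0_le_integral => //=.
- by move=> x _; rewrite lee_fin normal_pdf_ge0.
- by apply/measurable_EFinP/measurable_funTS; exact: measurable_normal_pdf.
- move=> x; rewrite in_itv/= => /andP[xa xb]; rewrite lee_fin.
  rewrite !normal_pdfE ?oner_eq0// ler_wpM2l ?normal_peak_ge0//.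
  by rewrite /normal_fun ler_expR !subr0 !expr1n; nra.
Qed.

(** The two open half-lines are disjoint and have equal mass by symmetry. *)
Lemma gauss_pos_le : (gam `]0%R, +oo[ <= (2^-1)%:E)%E.
Proof.
have h : (gam `]0%R, +oo[ + gam `]0%R, +oo[ <= 1)%E.
  have -> : (gam `]0%R, +oo[ + gam `]0%R, +oo[ =
             gam `]0%R, +oo[ + gam `]-oo, 0%R[)%E.
    congr (_ + _)%E.
    have iE (D : set R) : measurable D -> gam D = (\int[gam]_x (\1_D x : R)%:E)%E.
      by move=> mD; rewrite integral_indic// setIT.
    rewrite !iE// -(integral_std_normalN (f := fun x => (\1_(`]0, +oo[%classic : set R) x)%:E))//.
      2: exact: measurable_indicR.
    apply: eq_integral => x _; congr EFin; rewrite !indicE; congr (_%:R).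
    congr nat_of_bool.
    by rewrite !mem_setE !in_itv /= oppr_gt0; case: (x < 0).
  rewrite -measureU//; first by apply: probability_le1; exact: measurableU.
  by apply/seteqP; split => x //=; rewrite !in_itv/= andbT => -[h1 h2]; lra.
have f : gam `]0%R, +oo[ \is a fin_num by rewrite fin_num_measure.
by move: h; rewrite -(fineK f) -EFinD !lee_fin; lra.
Qed.

(** By symmetry and tilting the integral is [2 exp(t^2/2) P(Y >= -t)]. The density is at most
    [b / 2], so this probability is at most [(1 + t b) / 2], and [1 + t b <= exp(t b)]. The
    resulting bound is sub-Gaussian with variance factor 1 around the exact mean [b], as the
    threshold of the scan test demands. *)
Lemma gauss_mgf_abs t : 0 <= t ->
  (\int[gam]_x (expR (t * `|x|))%:E <= (expR (t ^+ 2 / 2 + t * b))%:E)%E.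
Proof.
move=> t0.
(* The two reflected halves both count [x = 0], which is harmless for an upper bound. *)
pose g x := (expR (t * x) * \1_(`[0, +oo[%classic : set R) x)%:E.
have mg : measurable_fun [set: R] g.
  apply/measurable_EFinP/measurable_funM; last exact: measurable_indic.
  by apply: measurableT_comp => //; exact: measurable_funM.
have g0 x : (0 <= g x)%E by rewrite lee_fin mulr_ge0 ?expR_ge0.
have mgN : measurable_fun [set: R] (fun x => g (- x)).
  by apply: (measurableT_comp mg); exact: oppr_measurable.
have me : measurable_fun [set: R] (fun x => (expR (t * `|x|))%:E).
  apply/measurable_EFinP; apply: measurableT_comp => //.
  by apply: measurable_funM => //; exact: measurableT_comp.
apply: (@le_trans _ _ (\int[gam]_x (g x + g (- x)%R))%E).
  apply: ge0_le_integral => //=.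
  - by apply: emeasurable_funD.
  - move=> x _; rewrite /g -EFinD lee_fin !indicE.
    case: (leP 0 x) => x0.
      rewrite mem_set/= ?in_itv/= ?x0// mulr1 ger0_norm// lerDl.
      by apply: mulr_ge0; [exact: expR_ge0|exact: ler0n].
    have -> : (x \in (`[0, +oo[%classic : set R)) = false.
      by rewrite mem_setE in_itv/= leNgt x0.
    have -> : (- x \in (`[0, +oo[%classic : set R)) = true.
      by rewrite mem_setE in_itv/= oppr_ge0 ltW.
    by rewrite mulr0 add0r mulr1 ltr0_norm.
rewrite ge0_integralD//.
rewrite (integral_std_normalN mg g0).
have : (\int[gam]_x g x <= (expR (t ^+ 2 / 2) * ((1 + t * b) / 2))%:E)%E.
  rewrite integral_normal_prob//.
  pose D : set R := `[0, +oo[%classic.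
  have mD : measurable D by exact: measurable_itv.
  (* Exponential tilting: multiplying the standard normal density by [exp(t x)] gives [exp(t^2/2)]
     times the density of N(t, 1). *)
  rewrite [leLHS](_ : _ = (\int[mu]_x ((expR (t ^+ 2 / 2))%:E *
      ((\1_D x : R)%:E * (normal_pdf t 1 x)%:E)))%E); last first.
    apply: eq_integral => x _; rewrite /g -!EFinM; congr EFin.
    have h : expR (t * x) * normal_fun 0 1 x =
        expR (t ^+ 2 / 2) * normal_fun t 1 x.
      by rewrite /normal_fun -!expRD; congr expR; rewrite !expr1n; field.
    rewrite -/D !normal_pdfE ?oner_eq0//.
    transitivity (\1_D x * normal_peak 1 * (expR (t * x) * normal_fun 0 1 x)).
      by ring.
    by rewrite h; ring.
  rewrite ge0_integralZl//; last 2 first.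
  - apply: emeasurable_funM; first exact: measurable_indicR.
    by apply/measurable_EFinP; exact: measurable_normal_pdf.
  - by move=> x _; rewrite mule_ge0// lee_fin normal_pdf_ge0.
  rewrite EFinM lee_pmul2l// ?lte_fin ?expR_gt0//.
  rewrite -(@integral_normal_prob _ t 1 (fun x => (\1_D x : R)%:E)) //; last exact: measurable_indicR.
  rewrite -(@integral_normal_affine _ t 1 ltr01 (fun x => (\1_D x : R)%:E)) //; last exact: measurable_indicR.
  (* The event [t + Y >= 0] is split at [Y = 0]: an interval of length [t] and a half-line. *)
  apply: (@le_trans _ _ (\int[gam]_x
      ((\1_(`[(- t)%R, 0%R]%classic : set R) x : R)%:E +
       (\1_(`]0%R, +oo[%classic : set R) x : R)%:E))%E).
    apply: ge0_le_integral => //=.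
    - apply: (@measurableT_comp _ _ _ _ _ _ (fun x => (\1_D x : R)%:E)) => //.
        exact: measurable_indicR.
      by apply: measurable_funD => //; exact: measurable_funM.
    - by apply: emeasurable_funD; exact: measurable_indicR.
    - move=> x _; rewrite -EFinD lee_fin !indicE !mem_setE !in_itv /= mul1r.
      by case: (leP 0 (t + x)) => h; case: (leP x 0) => h' //=;
        case: (leP (- t) x) => h'' //=; rewrite ?andbT//=; lra.
  rewrite ge0_integralD//; last 2 first.
  - exact: measurable_indicR.
  - exact: measurable_indicR.
  rewrite !integral_indic// !setIT.
  apply: (@le_trans _ _ (((0 - - t) * (b / 2))%:E + (2^-1)%:E))%E.
    by apply: leeD; [apply: gauss_itv_le; rewrite oppr_le0|exact: gauss_pos_le].
  by rewrite -EFinD lee_fin; lra.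
set I := (\int[_]_x _)%E.
move=> hI.
apply: (le_trans (leeD hI hI)).
rewrite -EFinD lee_fin expRD.
have := expR_ge1Dx (t * b); have := expR_gt0 (t ^+ 2 / 2).
set u := expR _; set v := expR _; move=> u0 hv; nra.
Qed.
End GaussAbsUpper.

(** * Mean and Laplace transform of |m + Y| *)

Section GaussAbsLower.
Context {R : realType}.
Local Notation mu := (@lebesgue_measure R).
Local Notation gam := (@normal_prob R 0 1).
Local Notation b := (Num.sqrt (2 / pi) : R).
Implicit Types (m s t x : R).

(** [- normal_pdf 0 1] is an antiderivative of [x * normal_pdf 0 1 x], so the value is the density
    at 0. *)
Lemma gauss_pos_part : (\int[gam]_x (Num.max x 0)%:E = (b / 2)%:E)%E.
Proof.
rewrite integral_normal_prob; last 2 first.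
- by apply/measurable_EFinP; exact: measurable_maxr.
- by move=> x; rewrite lee_fin le_max lexx orbT.
transitivity (\int[mu]_(x in `[0%R, +oo[) (x * normal_pdf 0 1 x)%:E)%E.
  rewrite [RHS]integral_mkcond/=; apply: eq_integral => x _.
  rewrite patchE mem_setE in_itv/= andbT; case: (leP 0 x) => x0 //.
  by rewrite mul0e.
pose F x := - normal_pdf 0 1 x : R.
have dpdf x : is_derive x 1 (normal_pdf 0 1 : R -> R) (- x * normal_pdf 0 1 x).
  pose g y := - 2^-1 * y ^+ 2 : R.
  have E : normal_pdf 0 1 = (fun y => normal_peak 1 * (expR \o g) y) :> (R -> R).
    apply/funext => y; rewrite normal_pdfE ?oner_eq0// /normal_fun /g /=.
    by congr (_ * expR _); rewrite subr0 expr1n; field.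
  have dg : is_derive x 1 g (- x).
    have -> : g = (cst (- 2^-1) * (@id R) ^+ 2)%R by apply/funext.
    by apply: is_derive_eq; rewrite /GRing.scale/=; field.
  have de : is_derive x 1 (expR \o g) (- x * expR (g x)).
    by apply: is_derive_eq; rewrite mulrC.
  have := is_deriveM (is_derive_cst (normal_peak 1 : R^o) x (1 : R)) de.
  rewrite E => h; apply: (is_derive_eq h); rewrite /GRing.scale/=; ring.
rewrite (@ge0_continuous_FTC2y _ _ F 0 0).
- rewrite /F -EFinB opprK add0r normal_pdfE ?oner_eq0// /normal_fun subrr expr0n/= oppr0 mul0r expR0 mulr1.
  by rewrite normal_peak1E.
- by move=> x x0; rewrite mulr_ge0// normal_pdf_ge0.
- apply: continuous_subspaceT => x; apply: cvgM; first exact: cvg_id.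
  by apply: continuous_normal_pdf; rewrite oner_eq0.
- rewrite -oppr0; apply: cvgN.
  rewrite -[X in _ --> X](mulr0 (normal_peak 1 : R)) normal_pdfE ?oner_eq0//.
  apply: cvgMr.
  (* For [x >= 2] one has [x^2 / 2 >= x], so [expR (- x)] dominates the Gaussian factor. *)
  apply: (@squeeze_cvgr _ _ _ _ (cst 0) (fun x => expR (- x))).
  + near=> x; rewrite /= normal_fun_ge0/= /normal_fun ler_expR subr0 expr1n.
    have : 2 <= x by near: x; exact: nbhs_pinfty_ge.
    by move=> h; nra.
  + exact: cvg_cst.
  + exact: cvgr_expR.
- by move=> x _; apply: derivableN; exact: ex_derive.
- apply: cvgN; apply: cvg_at_right_filter.
  by apply: continuous_normal_pdf; rewrite oner_eq0.
- move=> x _; rewrite derive1E deriveN; last exact: ex_derive.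
  by rewrite derive_val mulNr opprK.
Unshelve. all: by end_near. Qed.

Lemma gauss_abs : (\int[gam]_x (`|x|)%:E = b%:E)%E.
Proof.
have m1 : measurable_fun [set: R] (fun x => (Num.max x 0)%:E).
  by apply/measurable_EFinP; exact: measurable_maxr.
have p x : (0 <= (Num.max x 0)%:E)%E by rewrite lee_fin le_max lexx orbT.
transitivity (\int[gam]_x ((Num.max x 0)%:E + (Num.max (- x) 0)%:E))%E.
  apply: eq_integral => x _; rewrite -EFinD; congr EFin.
  by case: (ger0P x) => x0; case: (leP x 0) => x2; case: (leP 0 (- x)) => x1; lra.
rewrite ge0_integralD//; last first.
  by apply/measurable_EFinP; apply: measurable_maxr => //; exact: oppr_measurable.
rewrite (integral_std_normalN m1 p) gauss_pos_part -EFinD; congr EFin; lra.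
Qed.

Lemma measurable_abs_shift m : measurable_fun [set: R] (fun x => `|m + x|).
Proof. by apply: measurableT_comp => //; exact: measurable_funD. Qed.

Lemma gauss_abs_shift_sym m : (\int[gam]_x (`| - m + x|)%:E = \int[gam]_x (`|m + x|)%:E)%E.
Proof.
rewrite -(integral_std_normalN (f := fun x => (`|m + x|)%:E))//.
- by apply: eq_integral => x _; rewrite -normrN opprD opprK.
- by apply/measurable_EFinP; exact: measurable_abs_shift.
Qed.

(* By symmetry this is half of E (|m + Y| + |m - Y|) = 2 E max(m, |Y|). *)
Lemma gauss_abs_shift_ge m : 0 <= m ->
  ((b + normal_pdf 0 1 1 / 2 * (m * Num.min m 1))%:E <= \int[gam]_x (`|m + x|)%:E)%E.
Proof.
move=> m0.
set q := Num.min m 1; set c := normal_pdf 0 1 1.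
have q0 : 0 <= q by rewrite le_min m0 ler01.
have q1 : q <= 1 by rewrite ge_min lexx orbT.
have qm : q <= m by rewrite ge_min lexx.
(* On [D] one has [|x| <= m / 2], so [2 max(m, |x|)] exceeds [2 |x|] by at least [m]. Capping [q] at
   1 keeps [D] inside [-1, 1], where the density is at least [c]. *)
pose D : set R := `[- (q / 2), q / 2]%classic.
have mD : measurable D by exact: measurable_itv.
have mm n : measurable_fun [set: R] (fun x => (`|n + x|)%:E).
  by apply/measurable_EFinP; exact: measurable_abs_shift.
have mm0 := mm 0; have mm1 := mm m; have mmN := mm (- m).
have mI : measurable_fun [set: R] (fun x => (m * \1_D x : R)%:E).
  by apply/measurable_EFinP/measurable_funM => //; exact: measurable_indic.
have hD : ((q * c)%:E <= gam D)%E.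
  have := @gauss_itv_ge R (q / 2); rewrite -/c => h.
  have -> : q * c = 2 * (q / 2) * c by lra.
  by apply: h; lra.
have : (\int[gam]_x ((`|0 + x|)%:E + (`|0 + x|)%:E + (m * \1_D x)%:E) <=
        \int[gam]_x ((`|m + x|)%:E + (`|- m + x|)%:E))%E.
  apply: ge0_le_integral => //=.
  - by move=> x _; rewrite -!EFinD lee_fin !addr_ge0// mulr_ge0// indicE ler0n.
  - by apply: emeasurable_funD; [apply: emeasurable_funD; exact: mm|exact: mI].
  - by apply: emeasurable_funD; exact: mm.
  - move=> x _; rewrite -!EFinD lee_fin add0r indicE /D mem_setE in_itv/=.
    have h1 := ler_norm (m + x); have h2 := ler_norm (- (m + x)).
    have h3 := ler_norm (- m + x); have h4 := ler_norm (- (- m + x)).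
    rewrite !normrN in h2 h4.
    case: (leP 0 x) => x0; [rewrite (ger0_norm x0)|rewrite (ltr0_norm x0)];
      case: (leP (- (q / 2)) x) => h5; case: (leP x (q / 2)) => h6 /=; lra.
have m2 : measurable_fun [set: R] (fun x => (`|0 + x|)%:E + (`|0 + x|)%:E)%E.
  by apply: emeasurable_funD; exact: mm.
have pI x : [set: R] x -> (0 <= (m * \1_D x)%:E)%E.
  by move=> _; rewrite lee_fin mulr_ge0// indicE ler0n.
have p0 x : [set: R] x -> (0 <= (`|0 + x|)%:E + (`|0 + x|)%:E)%E.
  by move=> _; rewrite adde_ge0.
rewrite !ge0_integralD//.
rewrite gauss_abs_shift_sym.
have -> : (\int[gam]_x (m * \1_D x)%:E = m%:E * gam D)%E.
  under eq_integral do rewrite EFinM.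
  rewrite ge0_integralZl//; last exact: measurable_indicR.
  by rewrite integral_indic// setIT.
under eq_integral do rewrite add0r.
rewrite gauss_abs.
set I := (\int[_]_x _)%E.
have I0 : (0 <= I)%E by apply: integral_ge0 => x _; rewrite lee_fin.
have : ((m * (q * c))%:E <= m%:E * gam D)%E by rewrite EFinM; apply: lee_wpmul2l; rewrite ?lee_fin.
move: I I0 => [r| |]// _; last by move=> *; rewrite leey.
move=> h1 h2.
have := le_trans (leeD (lexx (b%:E + b%:E)%E) h1) h2.
rewrite -!EFinD !lee_fin; lra.
Qed.

(** A crude bound for E Y^2, from [x^2 <= 2 exp |x|] and [gauss_mgf_abs] at [t = 1]. Its size
    affects only constants in front of [log p]. *)
Definition gauss_sqr_bound : R := 2 * expR (2^-1 + b).

Lemma gauss_sqr_le : (\int[gam]_x (x ^+ 2)%:E <= gauss_sqr_bound%:E)%E.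
Proof.
have me : measurable_fun [set: R] (fun x => (expR (1 * `|x|))%:E).
  apply/measurable_EFinP; apply: measurableT_comp => //.
  by apply: measurable_funM => //; exact: measurableT_comp.
apply: (@le_trans _ _ (\int[gam]_x (2%:E * (expR (1 * `|x|))%:E))%E).
  apply: ge0_le_integral => //=.
  - by move=> x _; rewrite lee_fin sqr_ge0.
  - by apply/measurable_EFinP; exact: measurable_funX.
  - exact: emeasurable_funM.
  - move=> x _; rewrite -EFinM lee_fin mul1r.
    have := @expR_ge1Dxn R `|x| 1 (normr_ge0 _).
    rewrite -normrX ger0_norm ?sqr_ge0// (_ : 2`! = 2)%N//; lra.
rewrite ge0_integralZl//.
rewrite EFinM lee_pmul2l//.
have := @gauss_mgf_abs R 1 ler01.
by rewrite expr1n mul1r [1 * b]mul1r.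
Qed.

(** Integrate [exp(-u) <= 1 - u + u^2] at [u = t |m + x|], bound [(m + x)^2] by [2 m^2 + 2 x^2], and
    finish with [1 + v <= exp v]. *)
Lemma gauss_laplace_abs_shift t m : 0 <= t ->
  (\int[gam]_x (expR (- t * `|m + x|))%:E <=
   (expR (- t * (b + normal_pdf 0 1 1 / 2 * (`|m| * Num.min `|m| 1)) +
          t ^+ 2 * (2 * m ^+ 2 + 2 * gauss_sqr_bound)))%:E)%E.
Proof.
move=> t0.
have mm : measurable_fun [set: R] (fun x => (`|m + x|)%:E).
  by apply/measurable_EFinP; exact: measurable_abs_shift.
have mtm : measurable_fun [set: R] (fun x => t%:E * (`|m + x|)%:E)%E.
  exact: emeasurable_funM.
have me : measurable_fun [set: R] (fun x => (expR (- t * `|m + x|))%:E).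
  apply/measurable_EFinP; apply: measurableT_comp => //.
  by apply: measurable_funM => //; exact: measurable_abs_shift.
have mx2 : measurable_fun [set: R] (fun x => (x ^+ 2)%:E).
  by apply/measurable_EFinP; exact: measurable_funX.
(* The negative term is moved to the left so that both integrands are nonnegative. *)
have : (\int[gam]_x ((expR (- t * `|m + x|))%:E + t%:E * (`|m + x|)%:E) <=
        \int[gam]_x ((1 + t ^+ 2 * (2 * m ^+ 2))%:E + (2 * t ^+ 2)%:E * (x ^+ 2)%:E))%E.
  apply: ge0_le_integral => //=.
  - by move=> x _; rewrite -EFinM -EFinD lee_fin addr_ge0// ?expR_ge0// mulr_ge0.
  - exact: emeasurable_funD.
  - by apply: emeasurable_funD => //; exact: emeasurable_funM.
  - move=> x _; rewrite -!EFinM -!EFinD lee_fin.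
    set y := `|m + x|.
    have y0 : 0 <= t * y by rewrite mulr_ge0// normr_ge0.
    have y2 : y ^+ 2 <= 2 * m ^+ 2 + 2 * x ^+ 2.
      by rewrite /y -normrX ger0_norm ?sqr_ge0//; have := sqr_ge0 (m - x); lra.
    have h1 := expR_ge1Dx (t * y); rewrite mulNr expRN.
    have e0 := expR_gt0 (t * y).
    (* With [u = t y], [(1 - u + u^2)(1 + u) = 1 + u^3 >= 1]. *)
    have h2 : (expR (t * y))^-1 <= 1 - t * y + (t * y) ^+ 2.
      move: h1 e0 y0; set u := t * y; set e := expR u => h1 e0 y0.
      rewrite -[leLHS]mul1r ler_pdivrMr//.
      have q0 : 0 <= 1 - u + u ^+ 2 by nra.
      apply: le_trans (ler_wpM2l q0 h1).
      have u3 : 0 <= u ^+ 3 by exact: exprn_ge0.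
      by lra.
    apply: le_trans (lerD h2 (lexx _)) _.
    have : t ^+ 2 * y ^+ 2 <= t ^+ 2 * (2 * m ^+ 2 + 2 * x ^+ 2).
      by rewrite ler_wpM2l// sqr_ge0.
    rewrite exprMn; lra.
have p1 x : [set: R] x -> (0 <= (1 + t ^+ 2 * (2 * m ^+ 2))%:E)%E.
  by move=> _; rewrite lee_fin; have h1 := sqr_ge0 t; have h2 := sqr_ge0 m; nra.
have p2 x : [set: R] x -> (0 <= (2 * t ^+ 2)%:E * (x ^+ 2)%:E)%E.
  by move=> _; rewrite -EFinM lee_fin; have h1 := sqr_ge0 t; have h2 := sqr_ge0 x; nra.
have p3 x : [set: R] x -> (0 <= (expR (- t * `|m + x|))%:E)%E.
  by move=> _; rewrite lee_fin expR_ge0.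
have p4 x : [set: R] x -> (0 <= t%:E * (`|m + x|)%:E)%E.
  by move=> _; rewrite -EFinM lee_fin mulr_ge0.
have p5 x : [set: R] x -> (0 <= (x ^+ 2)%:E)%E.
  by move=> _; rewrite lee_fin sqr_ge0.
have mt2 : measurable_fun [set: R] (fun x => (2 * t ^+ 2)%:E * (x ^+ 2)%:E)%E.
  exact: emeasurable_funM.
have t2 : (0 <= (2 * t ^+ 2)%:E)%E by rewrite lee_fin mulr_ge0// sqr_ge0.
rewrite !ge0_integralD//.
rewrite integral_cst//= probability_setT mule1.
rewrite ge0_integralZl//.
rewrite ge0_integralZl//.
have : (t%:E * (b + normal_pdf 0 1 1 / 2 * (`|m| * Num.min `|m| 1))%:E <=
  t%:E * \int[gam]_x `|m + x|%:E)%E.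
  apply: lee_wpmul2l => //.
  case: (leP 0 m) => m0; first by rewrite ger0_norm//; exact: gauss_abs_shift_ge.
  rewrite ltr0_norm// -gauss_abs_shift_sym; apply: gauss_abs_shift_ge.
  by rewrite oppr_ge0 ltW.
have : ((2 * t ^+ 2)%:E * \int[gam]_x (x ^+ 2)%:E <= (2 * t ^+ 2)%:E * gauss_sqr_bound%:E)%E.
  by apply: lee_wpmul2l; [rewrite lee_fin mulr_ge0// sqr_ge0|exact: gauss_sqr_le].
set I := (\int[_]_x (expR _)%:E)%E.
set J := (_ * \int[_]_x (_ ^+ 2)%:E)%E.
set K := (t%:E * \int[_]_x _)%E.
rewrite -!EFinM.
move=> hJ hK h.
have := le_trans (leeD (lexx I) hK) (le_trans h (leeD (lexx _) hJ)).
have I0 : (0 <= I)%E by apply: integral_ge0 => x _; rewrite lee_fin expR_ge0.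
move: I I0 {h} => [r| |]// _.
rewrite -!EFinD !lee_fin => h.
apply: le_trans (expR_ge1Dx _); lra.
Qed.
End GaussAbsLower.

(** * Independence *)

Section Independence.
Context {R : realType} {d : measure_display} {T : measurableType d}.
Variable P : probability T R.
Context {I : finType}.
Variable X : I -> {RV P >-> R}.

(** A pi-system generating the sigma-algebra of the [X i] with [i] in [J]. Intersecting over all of
    [I], with [setT] off [J], lets the product rule of [mutually_independent] apply as it is. *)
Definition cylinder (J : pred I) : set (set T) :=
  [set A | exists B : I -> set R,
    [/\ forall i, measurable (B i), forall i, ~~ J i -> B i = setT
      & A = \bigcap_(i in [set: I]) (X i @^-1` B i)]].

(** It says that [U] is a Borel function of the subfamily indexed by [J], without exhibiting the
    function. *)
Definition depends_on (J : pred I) (U : T -> R) : Prop :=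
  measurable_fun [set: g_sigma_algebraType (cylinder J)] U.

Lemma cylinder_measurable J : cylinder J `<=` measurable.
Proof.
move=> _ [B [mB _ ->]]; apply: fin_bigcap_measurable => // i _.
exact: measurable_funPTI.
Qed.

Lemma sigma_cylinder_measurable J : <<s cylinder J >> `<=` measurable.
Proof.
exact: smallest_sub (@sigma_algebra_measurable _ T) (@cylinder_measurable J).
Qed.

Lemma cylinderT J : cylinder J setT.
Proof.
exists (fun=> setT); split => //.
by apply/seteqP; split => // w _ i _.
Qed.

Lemma cylinderI J : setI_closed (cylinder J).
Proof.
move=> _ _ [B [mB BJ ->]] [C [mC CJ ->]].
exists (fun i => B i `&` C i); split.
- by move=> i; exact: measurableI.
- by move=> i /[dup] /BJ -> /CJ ->; rewrite setIT.
- apply/seteqP; split => w /=.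
    by move=> [h1 h2] i _; split; [exact: h1|exact: h2].
  by move=> h; split => i _; have [] := h i Logic.I.
Qed.

Lemma sub_cylinder (J K : pred I) : subpred J K -> cylinder J `<=` cylinder K.
Proof.
move=> JK _ [B [mB BJ ->]]; exists B; split => // i iK.
by apply: BJ; apply: contra iK; exact: JK.
Qed.

Lemma sub_sigma_cylinder (J K : pred I) : subpred J K ->
  <<s cylinder J >> `<=` <<s cylinder K >>.
Proof.
move=> JK; apply: sub_smallest2r; first exact: smallest_sigma_algebra.
exact: sub_cylinder.
Qed.

Lemma depends_on_sigma J U (B : set R) : depends_on J U -> measurable B ->
  <<s cylinder J >> (U @^-1` B).
Proof. by move=> hU mB; rewrite -[_ @^-1` _]setTI; exact: hU. Qed.

Lemma depends_on_sub (J K : pred I) U : subpred J K ->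
  depends_on J U -> depends_on K U.
Proof.
move=> JK hU _ B mB; rewrite setTI; apply: (sub_sigma_cylinder JK).
exact: depends_on_sigma.
Qed.

Lemma depends_on_measurable J U : depends_on J U -> measurable_fun [set: T] U.
Proof.
move=> hU _ B mB; rewrite setTI; apply: (@sigma_cylinder_measurable J).
exact: depends_on_sigma.
Qed.

Lemma depends_on_RV (J : pred I) i : J i -> depends_on J (X i).
Proof.
move=> Ji _ B mB; rewrite setTI; apply: sub_sigma_algebra.
exists (fun j => if j == i then B else setT); split.
- by move=> j; case: ifP.
- by move=> j; case: eqP => // -> /negP.
- apply/seteqP; split => w /=; first by move=> h j _; case: eqP => // ->.
  by move=> /(_ i Logic.I); rewrite eqxx.
Qed.

Hypothesis indX : mutually_independent X.

(** At each index at most one of the two constraints is nontrivial, so the product over [I] factors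
    termwise. *)
Lemma indep_cylinder (J K : pred I) A B : (forall i, J i -> ~~ K i) ->
  cylinder J A -> cylinder K B -> P (A `&` B) = (P A * P B)%E.
Proof.
move=> JK [A' [mA AJ ->]] [B' [mB BK ->]].
rewrite [X in P X](_ : _ = \bigcap_(i in [set: I]) (X i @^-1` (A' i `&` B' i))); last first.
  apply/seteqP; split => w /=.
    by move=> [h1 h2] i _; split; [exact: h1|exact: h2].
  by move=> h; split => i _; have [] := h i Logic.I.
rewrite !indX//; last by move=> i; exact: measurableI.
rewrite -big_split/=; apply: eq_bigr => i _.
have [Ji|Ji] := boolP (J i).
  by rewrite (BK i (JK i Ji)) setIT preimage_setT probability_setT mule1.
by rewrite (AJ i Ji) setTI preimage_setT probability_setT mul1e.
Qed.

(* Two passes of the pi-lambda theorem, one for each factor. *)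
Lemma indep_sigma (J K : pred I) A B : (forall i, J i -> ~~ K i) ->
  <<s cylinder J >> A -> <<s cylinder K >> B -> P (A `&` B) = (P A * P B)%E.
Proof.
move=> JK hA hB.
have step (L : pred I) (C : set T) : measurable C ->
    (forall D, cylinder L D -> P (D `&` C) = (P D * P C)%E) ->
    forall D, <<s cylinder L >> D -> P (D `&` C) = (P D * P C)%E.
  move=> mC hC D hD.
  have fC : 0 <= fine (P C) by rewrite fine_ge0.
  (* For fixed [C] both sides are finite measures in [D] that agree on the pi-system. [fine]
     supplies the real scaling factor. *)
  have : mrestr P mC D = mscale (NngNum fC) P D.
    apply: (g_sigma_algebra_measure_unique (cylinder L)
      (@cylinder_measurable L) (fun=> setT)) => //.
    - by move=> _; exact: cylinderT.
    - by rewrite -subTset => w _; exists 0%N.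
    - exact: cylinderI.
    - move=> E hE; change (P (E `&` C) = (fine (P C))%:E * P E)%E.
      rewrite fineK ?fin_num_measure//.
      by rewrite hC// muleC.
    - move=> _; change (P (setT `&` C) < +oo)%E.
      by rewrite setTI ltey_eq fin_num_measure.
  change (P (D `&` C) = (fine (P C))%:E * P D -> P (D `&` C) = P D * P C)%E.
  by rewrite fineK ?fin_num_measure// muleC.
have mB := sigma_cylinder_measurable hB.
apply: (step J) => // A' cA'.
rewrite setIC muleC; apply: (step K) => //.
  exact: cylinder_measurable cA'.
by move=> B' cB'; rewrite setIC muleC; exact: indep_cylinder JK cA' cB'.
Qed.

(** Independence on rectangles identifies the joint law with the product of the laws, and Tonelli
    then separates the integrals. *)
Lemma integral_indep_pair (J K : pred I) U V (f : R * R -> \bar R) :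
  (forall i, J i -> ~~ K i) -> depends_on J U -> depends_on K V ->
  measurable_fun [set: R * R] f -> (forall z, 0 <= f z)%E ->
  (\int[P]_w f (U w, V w) = \int[P]_w \int[P]_w' f (U w, V w'))%E.
Proof.
move=> JK hU hV mf f0.
have mU := depends_on_measurable hU; have mV := depends_on_measurable hV.
pose U' : {RV P >-> R} := HB.pack U (isMeasurableFun.Build _ _ _ _ U mU).
pose V' : {RV P >-> R} := HB.pack V (isMeasurableFun.Build _ _ _ _ V mV).
have mUV : measurable_fun [set: T] (fun w => (U w, V w)) by exact: measurable_fun_pair.
have mxs x : measurable_fun [set: R] (fun y => f (x, y)) by exact: measurableT_comp.
have -> : (\int[P]_w f (U w, V w) = \int[image_measure P mUV]_z f z)%E.
  by rewrite ge0_integral_pushforward.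
transitivity (\int[distribution P U' \x distribution P V']_z f z)%E.
  apply: eq_measure_integral => A mA _.
  symmetry; apply: product_measure_unique => // B C mB mC.
  rewrite /= /pushforward /distribution/= /pushforward.
  rewrite -(indep_sigma JK (depends_on_sigma hU mB) (depends_on_sigma hV mC)).
  by [].
rewrite fubini_tonelli1//.
rewrite ge0_integral_distribution//.
- by apply: eq_integral => w _ /=; rewrite /fubini_F ge0_integral_distribution.
- exact: measurable_fun_fubini_tonelli_F.
- by move=> x; apply: integral_ge0.
Qed.

Lemma integral_indep_mul (J K : pred I) U V :
  (forall i, J i -> ~~ K i) -> depends_on J U -> depends_on K V ->
  (forall w, 0 <= U w) -> (forall w, 0 <= V w) ->
  (\int[P]_w (U w * V w)%:E = (\int[P]_w (U w)%:E) * \int[P]_w (V w)%:E)%E.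
Proof.
move=> JK hU hV U0 V0.
have mU := depends_on_measurable hU; have mV := depends_on_measurable hV.
(* The absolute value makes the integrand nonnegative on the whole plane; it disappears because [U]
   and [V] are nonnegative. *)
have mf : measurable_fun [set: R * R] (fun z : R * R => (`|z.1 * z.2|)%:E).
  apply/measurable_EFinP; apply: measurableT_comp => //.
  exact: measurable_funM.
have := integral_indep_pair JK hU hV mf (fun z => normr_ge0 _).
under eq_integral do rewrite /= ger0_norm ?mulr_ge0//.
move=> ->.
have mUE : measurable_fun [set: T] (fun w => (U w)%:E) by exact/measurable_EFinP.
have mVE : measurable_fun [set: T] (fun w => (V w)%:E) by exact/measurable_EFinP.
have pU w : [set: T] w -> (0 <= (U w)%:E)%E by rewrite lee_fin.
have pV w : [set: T] w -> (0 <= (V w)%:E)%E by rewrite lee_fin.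
have iV : (0 <= \int[P]_w (V w)%:E)%E by exact: integral_ge0.
rewrite -ge0_integralZr//; apply: eq_integral => w _.
rewrite -ge0_integralZl// ?lee_fin//; apply: eq_integral => w' _.
by rewrite /= ger0_norm ?mulr_ge0.
Qed.

Lemma depends_on_prod (L : eqType) (s : seq L) (J : L -> pred I) (H : L -> T -> R) :
  (forall l, depends_on (J l) (H l)) ->
  depends_on (fun i => has (fun l => J l i) s) (fun w => \prod_(l <- s) H l w).
Proof.
move=> hH; elim: s => [|l s IH].
  rewrite (_ : (fun w : T => _) = cst 1); first exact: measurable_cst.
  by apply/funext => w; rewrite big_nil.
rewrite (_ : (fun w : T => _) = fun w => H l w * \prod_(l' <- s) H l' w); last first.
  by apply/funext => w; rewrite big_cons.
apply: measurable_funM.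
  by apply: depends_on_sub (hH l) => i /= ->.
by apply: depends_on_sub IH => i /= ->; rewrite orbT.
Qed.

Lemma depends_on_sum (L : Type) (s : seq L) (Q : pred L) (J : pred I) (H : L -> T -> R) :
  (forall l, Q l -> depends_on J (H l)) ->
  depends_on J (fun w => \sum_(l <- s | Q l) H l w).
Proof.
move=> hH; elim: s => [|l s IH].
  rewrite (_ : (fun w : T => _) = cst 0); first exact: measurable_cst.
  by apply/funext => w; rewrite big_nil.
rewrite (_ : (fun w : T => _) = fun w => if Q l then H l w + \sum_(l' <- s | Q l') H l' w
    else \sum_(l' <- s | Q l') H l' w); last first.
  by apply/funext => w; rewrite big_cons.
by case: (boolP (Q l)) => // Ql; apply: measurable_funD => //; exact: hH.
Qed.

Lemma integral_indep_prod (L : finType) (J : L -> pred I) (H : L -> T -> R) :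
  (forall l l' i, l != l' -> J l i -> ~~ J l' i) ->
  (forall l, depends_on (J l) (H l)) -> (forall l w, 0 <= H l w) ->
  (\int[P]_w (\prod_l H l w)%:E = \prod_l \int[P]_w (H l w)%:E)%E.
Proof.
move=> dJ hH H0.
have := index_enum_uniq L; elim: (index_enum L) => [_|l s IH /= /andP[ls us]].
  by under eq_integral do rewrite big_nil; rewrite big_nil integral_cst//= probability_setT mule1.
under eq_integral do rewrite big_cons.
rewrite big_cons -IH//.
apply: (@integral_indep_mul (J l) (fun i => has (fun l => J l i) s)) => //.
- move=> i Jli; apply/hasPn => l' l's; apply: dJ Jli.
  by apply: contraNneq ls => ->.
- exact: depends_on_prod.
- by move=> w; apply: prodr_ge0.
Qed.

(** The Chernoff parameter is absorbed into [W]; a negative parameter there gives lower tails. *)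
Lemma indep_chernoff (L : finType) (J : L -> pred I) (W : L -> T -> R) (c s : R) :
  (forall l l' i, l != l' -> J l i -> ~~ J l' i) ->
  (forall l, depends_on (J l) (W l)) ->
  (forall l, \int[P]_w (expR (W l w))%:E <= (expR c)%:E)%E ->
  (P [set w | s <= \sum_l W l w]%R <= (expR (#|L|%:R * c - s))%:E)%E.
Proof.
move=> dJ hW hc.
have mS : measurable_fun [set: T] (fun w => \sum_l W l w).
  apply: (@depends_on_measurable predT); apply: depends_on_sum => l _.
  by apply: depends_on_sub (hW l).
set A := [set w | _].
have mA : measurable A.
  have -> : A = (fun w => \sum_l W l w) @^-1` `[s, +oo[%classic.
    by apply/seteqP; split => w /=; rewrite in_itv/= andbT.
  by rewrite -[_ @^-1` _]setTI; exact: mS.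
rewrite -[A]setIT -integral_indic//.
have mE : measurable_fun [set: T] (fun w => (expR (\sum_l W l w))%:E).
  by apply/measurable_EFinP; exact: measurableT_comp.
apply: (@le_trans _ _ (\int[P]_w ((expR (- s))%:E * (expR (\sum_l W l w))%:E))%E).
  apply: ge0_le_integral => //=.
  - by apply/measurable_EFinP; exact: measurable_indic.
  - exact: emeasurable_funM.
  - move=> w _; rewrite -EFinM lee_fin -expRD indicE.
    case: (boolP (w \in A)) => [/set_mem h|_]; last exact: expR_ge0.
    by rewrite -[leLHS]expR0 ler_expR addrC subr_ge0.
have pE w : [set: T] w -> (0 <= (expR (\sum_l W l w))%:E)%E.
  by rewrite lee_fin expR_ge0.
have ps : (0 <= (expR (- s))%:E)%E by rewrite lee_fin expR_ge0.
rewrite ge0_integralZl//.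
under eq_integral do rewrite expR_sum.
have hWe l : depends_on (J l) (fun w => expR (W l w)).
  by apply: measurableT_comp => //; exact: hW.
rewrite (@integral_indep_prod L J (fun l w => expR (W l w)) dJ hWe)//.
rewrite expRD mulrC EFinM; apply: lee_wpmul2l => //.
apply: (@le_trans _ _ (\prod_(l : L) (expR c)%:E)%E).
  (* Nonnegativity is carried through the induction because extended real products are monotone only
     in nonnegative factors. *)
  have /andP[] // : ((0 <= \prod_l \int[P]_w (expR (W l w))%:E) &&
    (\prod_l \int[P]_w (expR (W l w))%:E <= \prod_(l : L) (expR c)%:E))%E.
  apply: (big_ind2 (fun x y => (0 <= x) && (x <= y))%E).
  - by rewrite lee01 lexx.
  - move=> x1 x2 y1 y2 /andP[h1 h2] /andP[h3 h4].
    by rewrite mule_ge0//= lee_pmul.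
  - by move=> l _; rewrite hc andbT; apply: integral_ge0 => w _; rewrite lee_fin expR_ge0.
by rewrite prodEFin prodr_const -expRM_natl.
Qed.

Lemma integral_std_normal_RV i (f : R -> \bar R) : has_std_normal_law (X i) ->
  measurable_fun [set: R] f -> (forall x, 0 <= f x)%E ->
  (\int[P]_w f (X i w) = \int[normal_prob 0 1]_x f x)%E.
Proof.
move=> hi mf f0; rewrite -[LHS](@ge0_integral_distribution _ _ _ _ _ P (X i) f mf f0).
have mid : measurable_fun [set: measurableTypeR R] (fun x : measurableTypeR R => x : R) by [].
rewrite -[RHS](@ge0_integral_pushforward _ _ _ _ _ _ mid (normal_prob 0 1) setT f)//.
by apply: eq_measure_integral => A mA _; exact: hi.
Qed.

(** The induction runs over all test functions [f], since its step applies the hypothesis to the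
    partially integrated function [u |-> E f(u + Y)]. *)
Lemma integral_sum_std_normal (s : seq I) (f : R -> \bar R) : uniq s ->
  (forall i, i \in s -> has_std_normal_law (X i)) ->
  measurable_fun [set: R] f -> (forall x, 0 <= f x)%E ->
  (\int[P]_w f (\sum_(i <- s) X i w)%R =
   \int[normal_prob 0 1]_x f (Num.sqrt (size s)%:R * x)%R)%E.
Proof.
elim: s f => [|i s IH] f /= us hs mf f0.
  under eq_integral do rewrite big_nil.
  under [RHS]eq_integral do rewrite sqrtr0 mul0r.
  by rewrite !integral_cst//= !probability_setT.
move: us => /andP[ni us].
under eq_integral do rewrite big_cons addrC.
have mfD : measurable_fun [set: R * R] (fun z : R * R => f (z.1 + z.2)).
  by apply: measurableT_comp => //; exact: measurable_funD.
have hS : depends_on (fun j => j \in s) (fun w => \sum_(j <- s) X j w).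
  rewrite (_ : (fun w : T => _) = fun w => \sum_(j <- s | j \in s) X j w); last first.
    by apply/funext => w; rewrite big_seq.
  by apply: depends_on_sum => j js; exact: (@depends_on_RV (fun j => j \in s) j js).
have hX : depends_on (pred1 i) (X i) by apply: depends_on_RV; rewrite /= eqxx.
have dis j : j \in s -> ~~ pred1 i j by move=> /= js; apply: contraNneq ni => <-.
rewrite (integral_indep_pair dis hS hX mfD)//.
have mfu u : measurable_fun [set: R] (fun y => f (u + y)).
  by apply: measurableT_comp => //; exact: measurable_funD.
transitivity (\int[P]_w (fun u => \int[normal_prob 0 1]_y f (u + y)%R) (\sum_(j <- s) X j w)%R)%E.
  apply: eq_integral => w _ /=.
  apply: (@integral_std_normal_RV i (fun y => f (\sum_(j <- s) X j w + y)%R)) => //.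
  by apply: hs; rewrite mem_head.
have mI : measurable_fun [set: R] (fun u => \int[normal_prob 0 1]_y f (u + y)%R)%E.
  apply: (@measurable_fun_fubini_tonelli_F _ _ R (measurableTypeR R) R (normal_prob 0 1)
    (fun z => f (z.1 + z.2)%R)) => //.
have I0 u : (0 <= \int[normal_prob 0 1]_y f (u + y)%R)%E by apply: integral_ge0.
have hs' j : j \in s -> has_std_normal_law (X j).
  by move=> js; apply: hs; rewrite inE js orbT.
rewrite (IH (fun u => \int[normal_prob 0 1]_y f (u + y)%R)%E us hs' mI I0).
have := @integral_std_normal_conv R (Num.sqrt (size s)%:R) 1 f (sqrtr_ge0 _) ltr01 mf f0.
under eq_integral do under eq_integral do rewrite mul1r.
by move=> ->; rewrite sqr_sqrtr ?ler0n// expr1n natr1.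
Qed.

End Independence.

(** * Tails of the row statistics *)

Section RowTails.
Context {R : realType} {d : measure_display} {T : measurableType d}.
Variable P : probability T R.
Context {I : finType}.
Variable X : I -> {RV P >-> R}.
Hypothesis indX : mutually_independent X.
Variables n p : nat.
(** The embedding serves both models: it is the identity under the null, and under the alternative
    it places the noise inside the larger family with signs and [mu]. *)
Variable e : 'I_n * 'I_p -> I.
Hypothesis inj_e : injective e.
Hypothesis normal_e : forall ij, has_std_normal_law (X (e ij)).
Variable S : {set 'I_p}.
Hypothesis S_gt0 : (0 < #|S|)%N.
Local Notation b := (Num.sqrt (2 / pi) : R).

(** The scaling by the square root of the size makes it standard normal for every nonempty [S]. *)
Definition row_mean (i : 'I_n) (w : T) : R :=
  (Num.sqrt #|S|%:R)^-1 * \sum_(j in S) X (e (i, j)) w.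

Definition row_indices (i : 'I_n) : pred I := fun k => [exists j, k == e (i, j)].

Lemma row_indices_disjoint i i' k : i != i' -> row_indices i k -> ~~ row_indices i' k.
Proof.
move=> ii' /existsP[j /eqP ->]; apply/existsP => -[j' /eqP/inj_e[ii _]].
by rewrite ii eqxx in ii'.
Qed.

Lemma depends_on_row_mean i : depends_on X (row_indices i) (row_mean i).
Proof.
apply: measurable_funM; first exact: measurable_cst.
apply: depends_on_sum => j _; apply: depends_on_RV.
by apply/existsP; exists j.
Qed.

Lemma integral_row_mean i (f : R -> \bar R) :
  measurable_fun [set: R] f -> (forall x, 0 <= f x)%E ->
  (\int[P]_w f (row_mean i w) = \int[normal_prob 0 1]_x f x)%E.
Proof.
move=> mf f0; rewrite /row_mean; set k := (Num.sqrt #|S|%:R)^-1.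
have us : uniq [seq e (i, j) | j <- enum S].
  by rewrite map_inj_uniq ?enum_uniq// => j j' /inj_e[].
have ns k' : k' \in [seq e (i, j) | j <- enum S] -> has_std_normal_law (X k').
  by move=> /mapP[j _ ->].
have mfk : measurable_fun [set: R] (fun x => f (k * x)).
  by apply: measurableT_comp => //; exact: measurable_funM.
have := integral_sum_std_normal indX us ns mfk (fun x => f0 _).
under eq_integral do rewrite big_map big_enum/=.
move=> ->; apply: eq_integral => x _.
rewrite size_map -cardE mulrA mulVf ?mul1r//.
by rewrite gt_eqF// sqrtr_gt0 ltr0n.
Qed.

Lemma row_chernoff (g : 'I_n -> R -> R) (c s : R) :
  (forall i, measurable_fun [set: R] (g i)) ->
  (forall i, \int[normal_prob 0 1]_x (expR (g i x))%:E <= (expR c)%:E)%E ->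
  (P [set w | s <= \sum_i g i (row_mean i w)]%R <= (expR (n%:R * c - s))%:E)%E.
Proof.
move=> mg hc.
have := @indep_chernoff _ _ _ P _ X indX _ row_indices
  (fun i w => g i (row_mean i w)) c s row_indices_disjoint.
rewrite card_ord; apply.
- by move=> i; apply: measurableT_comp => //; exact: depends_on_row_mean.
- move=> i; rewrite (integral_row_mean i (f := fun x => (expR (g i x))%:E))//.
  by apply/measurable_EFinP; exact: measurableT_comp.
Qed.

Hypothesis n_gt0 : (0 < n)%N.

Lemma chi2_upper_tail (L : R) : 0 < L -> 4 * L <= n%:R ->
  (P [set w | n%:R + 4 * Num.sqrt (n%:R * L) <= \sum_i row_mean i w ^+ 2]%R <=
   (expR (- L))%:E)%E.
Proof.
move=> L0 Ln; set q := Num.sqrt _.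
have n0 : 0 < n%:R :> R by rewrite ltr0n.
have nn0 : n%:R != 0 :> R by rewrite gt_eqF.
have q0 : 0 < q by rewrite sqrtr_gt0 mulr_gt0.
have q2 : q ^+ 2 = n%:R * L by rewrite sqr_sqrtr// mulr_ge0// ltW.
have LE : L = q ^+ 2 / n%:R by rewrite q2 mulrC mulKf.
(* The minimizer of [4 n t^2 - 4 t q]. The hypothesis [4 L <= n] means [q <= n / 2], hence
   [t <= 1/4] as [gauss_mgf_sqr] requires. *)
set t := q / (2 * n%:R).
have t0 : 0 < t by rewrite divr_gt0// mulr_gt0.
have t4 : t <= 4^-1.
  rewrite /t ler_pdivrMr ?mulr_gt0//.
  suff : 2 * q <= n%:R by lra.
  rewrite -(@ler_pXn2r _ 2) ?nnegrE ?mulr_ge0// ?(ltW q0)// exprMn q2.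
  by nra.
have := @row_chernoff (fun _ x => t * x ^+ 2) (t + 4 * t ^+ 2) (t * (n%:R + 4 * q)).
rewrite (_ : [set w | _] = [set w | n%:R + 4 * q <= \sum_i row_mean i w ^+ 2]); last first.
  by apply/seteqP; split => w /=; rewrite -mulr_sumr ler_pM2l.
have -> : n%:R * (t + 4 * t ^+ 2) - t * (n%:R + 4 * q) = - L.
  by rewrite LE /t; field.
apply.
- by move=> _; apply: measurable_funM => //; exact: measurable_funX.
- by move=> _; apply: gauss_mgf_sqr; rewrite (ltW t0).
Qed.

Lemma abs_upper_tail (M : R) : 0 < M ->
  (P [set w | b * n%:R + Num.sqrt (2 * n%:R * M) <= \sum_i `|row_mean i w|]%R <=
   (expR (- M))%:E)%E.
Proof.
move=> M0; set q := Num.sqrt (2 * _ * _).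
have n0 : 0 < n%:R :> R by rewrite ltr0n.
have nn0 : n%:R != 0 :> R by rewrite gt_eqF.
have q0 : 0 < q by rewrite sqrtr_gt0 !mulr_gt0.
have q2 : q ^+ 2 = 2 * n%:R * M by rewrite sqr_sqrtr// !mulr_ge0// ltW.
have ME : M = q ^+ 2 / (2 * n%:R) by rewrite q2; field.
(* The minimizer of [n t^2 / 2 - t q], with minimum exactly [- M]. *)
set t := q / n%:R.
have t0 : 0 < t by rewrite divr_gt0.
have := @row_chernoff (fun _ x => t * `|x|) (t ^+ 2 / 2 + t * b) (t * (b * n%:R + q)).
rewrite (_ : [set w | _] = [set w | b * n%:R + q <= \sum_i `|row_mean i w|]); last first.
  by apply/seteqP; split => w /=; rewrite -mulr_sumr ler_pM2l.
have -> : n%:R * (t ^+ 2 / 2 + t * b) - t * (b * n%:R + q) = - M.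
  by rewrite ME /t; field.
apply.
- by move=> _; apply: measurable_funM => //; exact: measurableT_comp.
- by move=> _; apply: gauss_mgf_abs; rewrite (ltW t0).
Qed.

Variable sgn : 'I_n -> R.
Hypothesis sgn1 : forall i, `|sgn i| = 1.

Lemma sgnM_sqr i (m : R) : (sgn i * m) ^+ 2 = m ^+ 2.
Proof. by rewrite exprMn -(real_normK (num_real (sgn i))) sgn1 expr1n mul1r. Qed.

Lemma chi2_shift_lower_tail (L m : R) : 0 < L -> 4 * L <= n%:R ->
  (P [set w | \sum_i (sgn i * m + row_mean i w) ^+ 2 <=
              n%:R + 4 * Num.sqrt (n%:R * L)]%R <=
   (expR (6 * L - Num.sqrt (n%:R * L) * m ^+ 2 / 2))%:E)%E.
Proof.
move=> L0 Ln; set q := Num.sqrt _.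
have n0 : 0 < n%:R :> R by rewrite ltr0n.
have nn0 : n%:R != 0 :> R by rewrite gt_eqF.
have q0 : 0 < q by rewrite sqrtr_gt0 mulr_gt0.
have q2 : q ^+ 2 = n%:R * L by rewrite sqr_sqrtr// mulr_ge0// ltW.
have LE : L = q ^+ 2 / n%:R by rewrite q2 mulrC mulKf.
(* The terms [2 n t^2] and [4 t q] add up to [6 L], and [t <= 1/2] bounds the denominator [1 + 2t]
   of the signal term by 2. *)
set t := q / n%:R.
have t0 : 0 < t by rewrite divr_gt0.
have t2 : t <= 2^-1.
  rewrite /t ler_pdivrMr//.
  suff : 2 * q <= n%:R by lra.
  rewrite -(@ler_pXn2r _ 2) ?nnegrE ?mulr_ge0// ?(ltW q0)// exprMn q2.
  by nra.
have := @row_chernoff (fun i x => - t * (sgn i * m + x) ^+ 2)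
  (- t + 2 * t ^+ 2 - t * m ^+ 2 / 2) (- t * (n%:R + 4 * q)).
rewrite (_ : [set w | _] = [set w | \sum_i (sgn i * m + row_mean i w) ^+ 2 <=
              n%:R + 4 * q]); last first.
  by apply/seteqP; split => w /=; rewrite -mulr_sumr ler_nM2l ?oppr_lt0.
have -> : n%:R * (- t + 2 * t ^+ 2 - t * m ^+ 2 / 2) - - t * (n%:R + 4 * q) =
    6 * L - q * m ^+ 2 / 2.
  by rewrite LE /t; field.
apply.
- move=> i; apply: measurable_funM => //; apply: measurable_funX.
  exact: measurable_funD.
- move=> i; apply: le_trans (gauss_laplace_sqr_shift _ (ltW t0)) _.
  rewrite lee_fin ler_expR sgnM_sqr lerD2l lerN2.
  apply: ler_wpM2l; first by rewrite mulr_ge0 ?sqr_ge0// ltW.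
  by rewrite lef_pV2 ?posrE; lra.
Qed.

Lemma abs_shift_lower_tail (m h : R) : 0 < m ->
  let del := normal_pdf 0 1 1 / 2 * (m * Num.min m 1) in
  h <= n%:R * del / 2 ->
  (P [set w | \sum_i `|sgn i * m + row_mean i w| <= b * n%:R + h]%R <=
   (expR (- (n%:R * del ^+ 2 / (16 * (2 * m ^+ 2 + 2 * gauss_sqr_bound)))))%:E)%E.
Proof.
move=> m0 del hh.
have n0 : 0 < n%:R :> R by rewrite ltr0n.
have C0 : 0 < gauss_sqr_bound :> R by rewrite /gauss_sqr_bound mulr_gt0// expR_gt0.
set D := 2 * m ^+ 2 + _.
have D0 : 0 < D by rewrite addr_gt0// mulr_gt0// exprn_gt0.
have del0 : 0 < del.
  have c0 : 0 < normal_pdf 0 1 1 :> R.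
    by rewrite normal_pdfE ?oner_eq0// mulr_gt0 ?normal_peak_gt0 ?oner_eq0 ?expR_gt0.
  have m1 : 0 < Num.min m 1 by rewrite lt_min m0 ltr01.
  by rewrite mulr_gt0 ?mulr_gt0 ?divr_gt0.
(* The threshold uses at most half of the mean gain, so the exponent per row is at most
   [- t del / 2 + t^2 D]; this [t] minimizes it. *)
set t := del / (4 * D).
have t0 : 0 < t by rewrite divr_gt0// mulr_gt0.
have := @row_chernoff (fun i x => - t * `|sgn i * m + x|)
  (- t * (b + del) + t ^+ 2 * D) (- t * (b * n%:R + h)).
rewrite (_ : [set w | _] = [set w | \sum_i `|sgn i * m + row_mean i w| <=
              b * n%:R + h]); last first.
  by apply/seteqP; split => w /=; rewrite -mulr_sumr ler_nM2l ?oppr_lt0.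
move=> H; apply: (le_trans (H _ _)).
- move=> i; apply: measurable_funM => //; exact: measurable_abs_shift.
- move=> i; apply: le_trans (gauss_laplace_abs_shift _ (ltW t0)) _.
  rewrite lee_fin ler_expR normrM sgn1 mul1r (gtr0_norm m0) sgnM_sqr.
  exact: lexx.
rewrite lee_fin ler_expR.
have -> : - (n%:R * del ^+ 2 / (16 * D)) =
    n%:R * (- t * (b + del) + t ^+ 2 * D) + t * (b * n%:R + n%:R * del / 2).
  by rewrite /t; field; rewrite gt_eqF.
have : t * (b * n%:R + h) <= t * (b * n%:R + n%:R * del / 2).
  by rewrite ler_pM2l// lerD2l.
lra.
Qed.
End RowTails.

(** * The two tests under the null model *)

Section FiniteUnions.
Context {R : realType} {d : measure_display} {T : measurableType d}.
Variable P : probability T R.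

Lemma probability_le_subset (A B : set T) : measurable A -> measurable B ->
  A `<=` B -> (P A <= P B)%E.
Proof. by move=> mA mB; apply: le_measure; rewrite inE. Qed.

Lemma union_bound (F : Type) (s : seq F) (Q : pred F) (A : F -> set T) :
  (forall f, Q f -> measurable (A f)) ->
  (P (\big[setU/set0]_(f <- s | Q f) A f) <= \sum_(f <- s | Q f) P (A f))%E.
Proof.
move=> mA; elim: s => [|f s IH]; first by rewrite !big_nil measure0.
rewrite !big_cons; case: ifPn => // Qf.
apply: le_trans (leeD (lexx _) IH).
by apply: measureU2; [exact: mA|exact: bigsetU_measurable].
Qed.

Lemma sum_probability_fibers (F : finType) (f : T -> F) :
  (forall k, measurable (f @^-1` [set k])) -> (\sum_k P (f @^-1` [set k]) <= 1)%E.
Proof.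
move=> mf; rewrite -(probability_setT P).
under eq_bigr => k _ do rewrite -[f @^-1` _]setIT -integral_indic//.
rewrite -ge0_integral_sum//.
- rewrite -[P setT]mul1e -integral_cst//.
  rewrite le_eqVlt; apply/orP; left; apply/eqP.
  apply: eq_integral => w _; rewrite (bigD1 (f w))//= big1 ?adde0.
    by rewrite indicE mem_set.
  by move=> k kf; rewrite indicE memNset//= => /esym/eqP; rewrite (negbTE kf).
- by move=> k; apply/measurable_EFinP; exact: measurable_indic.
Qed.

(** Law of total probability for a finite-valued [f]: the event [E k] may vary with the value [k],
    as long as it is independent of the fiber over [k]. *)
Lemma conditioning_bound (F : finType) (f : T -> F) (Q : pred F)
    (E : F -> set T) (c : R) : 0 <= c ->
  (forall k, measurable (f @^-1` [set k])) -> (forall k, measurable (E k)) ->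
  (forall k, P (f @^-1` [set k] `&` E k) = P (f @^-1` [set k]) * P (E k))%E ->
  (forall k, Q k -> P (E k) <= c%:E)%E ->
  (P (\big[setU/set0]_(k | Q k) (f @^-1` [set k] `&` E k)) <= c%:E)%E.
Proof.
move=> c0 mf mE ind hc.
apply: (@le_trans _ _ (\sum_(k | Q k) (P (f @^-1` [set k]) * c%:E))%E).
  apply: le_trans (union_bound _ _) _ => [k _|]; first exact: measurableI.
  by apply: lee_sum => k Qk; rewrite ind; apply: lee_wpmul2l => //; exact: hc.
apply: (@le_trans _ _ (\sum_k (P (f @^-1` [set k]) * c%:E))%E).
  rewrite big_mkcond/=; apply: lee_sum => k _; case: ifP => // _.
  by rewrite mule_ge0// lee_fin.
rewrite -ge0_sume_distrl// -[leRHS]mul1e.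
by apply: lee_wpmul2r; rewrite ?lee_fin//; exact: sum_probability_fibers.
Qed.

End FiniteUnions.

(** * The test statistics as sums over rows *)

Section Statistics.
Context {R : realType}.
Variables n p : nat.
Implicit Types (M : 'M[R]_(n, p)) (S : {set 'I_p}).

Definition rowstat S M (i : 'I_n) : R :=
  (Num.sqrt #|S|%:R)^-1 * \sum_(j in S) M i j.

(** [p |xbar|^2] is the sum of squares of the normalized full row sums, and clearing the factor
    [(2n)^(-1/2)] turns the threshold into [4 sqrt(n log p)]. *)
Lemma T_starE M : (0 < n)%N -> (0 < p)%N ->
  T_star M = (n%:R + 4 * Num.sqrt (n%:R * ln p%:R) <= \sum_i rowstat [set: 'I_p]%SET M i ^+ 2).
Proof.
move=> n0 p0.
have n0' : 0 < n%:R :> R by rewrite ltr0n.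
have p0' : 0 < p%:R :> R by rewrite ltr0n.
have -> : \sum_i rowstat [set: 'I_p]%SET M i ^+ 2 = p%:R * norm2 (xbar M) ^+ 2.
  rewrite /norm2 sqr_sqrtr ?sumr_ge0// => [|i _]; last exact: sqr_ge0.
  rewrite mulr_sumr; apply: eq_bigr => i _.
  rewrite /rowstat /xbar mxE summxE finset.cardsT card_ord.
  rewrite !exprMn [RHS]mulrA; congr (_ * _).
    by rewrite exprVn sqr_sqrtr ?(ltW p0')//; field; rewrite gt_eqF.
  congr (_ ^+ 2); apply: eq_big => [j|j _]; first by rewrite inE.
  by rewrite mxE.
rewrite /T_star [_^-1 * _]mulrC ler_pdivlMr ?sqrtr_gt0 ?mulr_gt0// lerBrDl.
congr (_ + _ <= _).
rewrite -mulrA -sqrtrM; last by rewrite mulr_ge0// ln_ge0// ler1n.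
have -> : 2 * ln p%:R * (2 * n%:R) = 2 ^+ 2 * (n%:R * ln p%:R) :> R by ring.
rewrite sqrtrM ?sqr_ge0// sqrtr_sqr ger0_norm//; ring.
Qed.

Lemma sa_statE N M S : #|S| = N -> sa_stat N M S = \sum_i `|rowstat S M i|.
Proof.
move=> <-; rewrite /sa_stat /norm1 mulr_sumr; apply: eq_bigr => i _.
rewrite /rowstat normrM ger0_norm ?invr_ge0 ?sqrtr_ge0//.
by rewrite summxE; congr (_ * `| _ |); apply: eq_bigr => j _; rewrite mxE.
Qed.

Lemma bin_le_exp (m k : nat) : ('C(m, k) <= m ^ k)%N.
Proof.
apply: (@leq_trans (m ^_ k)).
  by rewrite -bin_ffact leq_pmulr// fact_gt0.
rewrite ffact_prod (@leq_trans (\prod_(i < k) m))//.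
  by apply: leq_prod => i _; exact: leq_subr.
by rewrite prod_nat_const card_ord.
Qed.

End Statistics.

Section Measurability.
Context {R : realType} {d : measure_display} {T : measurableType d}.
Variables n p : nat.
Variable X : T -> 'M[R]_(n, p).
Hypothesis mX : forall i j, measurable_fun [set: T] (fun w => X w i j).

Lemma measurable_rowstat S i : measurable_fun [set: T] (fun w => rowstat S (X w) i).
Proof.
apply: measurable_funM => //.
rewrite (_ : (fun w : T => _) = fun w => \sum_j (if j \in S then X w i j else 0)).
  by apply: measurable_sum => j; case: (j \in S).
by apply/funext => w; rewrite big_mkcond.
Qed.

Lemma measurable_ge_sum_rowstat (g : R -> R) S (thr : R) : measurable_fun [set: R] g ->
  measurable [set w | thr <= \sum_i g (rowstat S (X w) i)].
Proof.
move=> mg.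
have -> : [set w | thr <= \sum_i g (rowstat S (X w) i)] =
    (fun w => \sum_i g (rowstat S (X w) i)) @^-1` `[thr, +oo[%classic.
  by apply/seteqP; split => w /=; rewrite in_itv/= andbT.
rewrite -[_ @^-1` _]setTI; apply: measurable_sum => // i.
by apply: measurableT_comp => //; exact: measurable_rowstat.
Qed.

Lemma measurable_T_star : (0 < n)%N -> (0 < p)%N -> measurable [set w | T_star (X w)].
Proof.
move=> n0 p0; under eq_set do rewrite T_starE//.
by apply: (measurable_ge_sum_rowstat (g := fun x => x ^+ 2)).
Qed.

(** Rejection depends only on the maximal value, not on the maximizer selected. This gives
    measurability for an arbitrary [Shat] and prepares the union bound. *)
Lemma T_sa_eventE N (Shat : 'M[R]_(n, p) -> {set 'I_p}) :
  (forall M, sa_maximizer N M (Shat M)) ->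
  [set w | T_sa N Shat (X w)] =
  \big[setU/set0]_(S : {set 'I_p} | #|S| == N)
    [set w | Num.sqrt (2 / pi) * n%:R + Num.sqrt (2 * n%:R * ((N%:R + 2) * ln p%:R)) <=
             \sum_i `|rowstat S (X w) i|].
Proof.
move=> hS; rewrite -bigcup_seq_cond; apply/seteqP; split => w /=.
  move=> h; have [c _] := hS (X w).
  exists (Shat (X w)); first by rewrite /= mem_index_enum c eqxx.
  by rewrite /= -(sa_statE _ c) mulrA.
move=> [S /= /andP[_ /eqP c]]; rewrite -(sa_statE _ c) mulrA => h.
by apply: le_trans h _; have [_] := hS (X w); apply.
Qed.

Lemma measurable_T_sa N (Shat : 'M[R]_(n, p) -> {set 'I_p}) :
  (forall M, sa_maximizer N M (Shat M)) -> measurable [set w | T_sa N Shat (X w)].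
Proof.
move=> hS; rewrite T_sa_eventE//; apply: bigsetU_measurable => S _.
by apply: (measurable_ge_sum_rowstat (g := fun x => `|x|)).
Qed.

End Measurability.

Section NullModel.
Context {R : realType} {d : measure_display} {T : measurableType d}.
Variable P : probability T R.
Variables n p : nat.
Variable X : T -> 'M[R]_(n, p).
Hypothesis hX : null_model P X.
Hypotheses (n_gt0 : (0 < n)%N) (p_gt1 : (1 < p)%N).

Let lnp_gt0 : 0 < ln p%:R :> R.
Proof. by rewrite ln_gt0// ltr1n. Qed.

Lemma null_T_star : 4 * ln p%:R <= n%:R :> R ->
  (P [set w | T_star (X w)] <= (expR (- ln p%:R))%:E)%E.
Proof.
move=> hL; have [Z [indZ hZ XE]] := hX.
have p0 : (0 < p)%N by exact: ltnW.
have S0 : (0 < #|[set: 'I_p]%SET|)%N by rewrite finset.cardsT card_ord.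
have := @chi2_upper_tail _ _ _ P _ Z indZ n p id (@inj_id _) hZ [set: 'I_p]%SET S0 n_gt0 _ lnp_gt0 hL.
congr (P _ <= _)%E; apply/seteqP; split => w /=; rewrite T_starE// XE;
  congr (_ <= _); apply: eq_bigr => i _; congr (_ ^+ 2);
  by congr (_ * _); apply: eq_bigr => j _; rewrite mxE.
Qed.

Lemma null_T_sa (N : nat) (Shat : 'M[R]_(n, p) -> {set 'I_p}) : (0 < N)%N ->
  (forall M, sa_maximizer N M (Shat M)) ->
  (P [set w | T_sa N Shat (X w)] <= (expR (- ln p%:R))%:E)%E.
Proof.
move=> N0 hS; have [Z [indZ hZ XE]] := hX.
have mX i j : measurable_fun [set: T] (fun w => X w i j).
  rewrite (_ : (fun w : T => _) = Z (i, j)); first exact: measurable_funP.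
  by apply/funext => w; rewrite XE mxE.
rewrite T_sa_eventE//.
set M : R := (N%:R + 2) * ln p%:R.
have M0 : 0 < M by rewrite mulr_gt0// ltr_wpDl.
apply: le_trans (union_bound _ _ _) _ => [S _|].
  by apply: (measurable_ge_sum_rowstat mX (g := fun x => `|x|)).
apply: (@le_trans _ _ (\sum_(S : {set 'I_p} | #|S| == N) (expR (- M))%:E)%E).
  apply: lee_sum => S /eqP cS.
  have S0 : (0 < #|S|)%N by rewrite cS.
  have := @abs_upper_tail _ _ _ P _ Z indZ n p id (@inj_id _) hZ S S0 n_gt0 _ M0.
  congr (P _ <= _)%E; apply/seteqP; split => w /=; rewrite XE;
    congr (_ <= _); apply: eq_bigr => i _; congr (`|_|);
    by congr (_ * _); apply: eq_bigr => j _; rewrite mxE.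
rewrite sumEFin lee_fin sumr_const.
have -> : #|[pred S : {set 'I_p} | #|S| == N]| = 'C(p, N).
  have := card_draws 'I_p N; rewrite card_ord => <-.
  by rewrite cardsE.
have p0 : 0 < p%:R :> R by rewrite ltr0n ltnW.
apply: (@le_trans _ _ ((p ^ N)%:R * expR (- M))).
  by rewrite -[leLHS]mulr_natl ler_wpM2r ?expR_ge0// ler_nat bin_le_exp.
(* The count costs [N log p] out of [(N + 2) log p]; one of the two remaining [log p] is enough. *)
rewrite natrX -[p%:R in X in X <= _](@lnK R) ?posrE// -expRM_natl -expRD.
by rewrite ler_expR /M; have := lnp_gt0; lra.
Qed.

End NullModel.

(** * Conditioning on signs and support under the alternative *)

Section AltModel.
Context {R : realType} {d : measure_display} {T : measurableType d}.
Variable P : probability T R.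
Variables n p : nat.
Variables (ep ta : R).
Variables (ell : 'I_n -> {RV P >-> R}) (mu : 'I_p -> {RV P >-> R})
          (Z : 'I_n * 'I_p -> {RV P >-> R}).
Local Notation I := ('I_n + 'I_p + 'I_n * 'I_p)%type.
Let F : I -> {RV P >-> R} := ARW_family ell mu Z.
Hypothesis indF : mutually_independent F.
Hypothesis hell : forall i, has_two_point_law (2^-1) 1 (-1) (ell i).
Hypothesis hmu : forall j, has_two_point_law ep ta 0 (mu j).
Hypothesis hZ : forall ij, has_std_normal_law (Z ij).
Variable X : T -> 'M[R]_(n, p).
Hypothesis XE : forall w, X w = \matrix_(i, j) (ell i w * mu j w + Z (i, j) w).
Hypothesis ta_gt0 : 0 < ta.

Lemma measurable_alt_entry i j : measurable_fun [set: T] (fun w => X w i j).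
Proof.
rewrite (_ : (fun w : T => _) = (fun w => ell i w * mu j w + Z (i, j) w)).
  by apply: measurable_funD => //; exact: measurable_funM.
by apply/funext => w; rewrite XE mxE.
Qed.

Lemma two_point_law_support (c a b : R) (Y : {RV P >-> R}) :
  has_two_point_law c a b Y -> P (Y @^-1` ~` [set a; b]) = 0%E.
Proof.
move=> hY; have -> : P (Y @^-1` ~` [set a; b]) = distribution P Y (~` [set a; b]) by [].
rewrite hY; last by apply: measurableC; apply: measurableU.
rewrite !diracE !memNset ?mule0 ?adde0//=.
- by apply; right.
- by apply; left.
Qed.

(** Since [exp(-1) <= 1/2], each indicator has E exp(-1_A) at most [1 - ep / 2 <= exp(- ep / 2)].
    Chernoff at level [p ep / 4] keeps half of the exponent. *)
Lemma support_size_lower_tail :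
  (P [set w | #|[set j | mu j w == ta]%SET|%:R <= p%:R * ep / 4]%R <=
    (expR (- (p%:R * ep / 4)))%:E)%E.
Proof.
pose W (j : 'I_p) w : R := - \1_[set ta] (mu j w).
have mI : measurable_fun [set: R] (fun x => \1_[set ta] x : R) by exact: measurable_indic.
have h := @indep_chernoff _ _ _ P _ F indF _ (fun j => pred1 (inl (inr j)))
  W (- (ep / 2)) (- (p%:R * ep / 4)).
have -> : [set w | #|[set j | mu j w == ta]%SET|%:R <= p%:R * ep / 4] =
  [set w | - (p%:R * ep / 4) <= \sum_j W j w].
  have cE w : #|[set j | mu j w == ta]%SET|%:R = - \sum_j W j w.
    rewrite -sum1_card natr_sum big_mkcond/= -sumrN; apply: eq_bigr => j _.
    by rewrite inE opprK indicE classical_sets.in_set1; case: eqP.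
  by apply/seteqP; split => w /=; rewrite cE lerNl.
rewrite [X in expR X](_ : _ = #|'I_p|%:R * - (ep / 2) - - (p%:R * ep / 4)); last first.
  by rewrite card_ord; field.
apply: h.
- by move=> j j' k jj' /eqP ->; apply: contra jj' => /eqP[->].
- move=> j; apply: measurableT_comp => //; apply: measurableT_comp => //.
  exact: (@depends_on_RV _ _ _ P _ F (pred1 (inl (inr j))) (inl (inr j)) (eqxx _)).
move=> j; set A := mu j @^-1` [set ta].
have mA : measurable A by rewrite -[A]setTI; exact: measurable_funP.
have PA : P A = ep%:E.
  have -> : P A = distribution P (mu j) [set ta] by [].
  rewrite hmu//= !diracE mem_set// memNset ?mule0 ?adde0 ?mule1//=.
  by move=> /eqP; rewrite lt_eqF.
apply: (@le_trans _ _ (\int[P]_w ((2^-1)%:E * (\1_A w)%:E + (\1_(~` A) w)%:E))%E).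
  apply: ge0_le_integral => //=.
  - apply/measurable_EFinP; apply: measurableT_comp => //; apply: measurableT_comp => //.
    by apply: measurableT_comp => //; exact: measurable_funP.
  - apply: emeasurable_funD; [apply: emeasurable_funM => //|];
      apply/measurable_EFinP; apply: measurable_indic => //; exact: measurableC.
  - move=> w _; rewrite -EFinM -EFinD lee_fin /W !indicE in_setC.
    have -> : (w \in A) = (mu j w \in [set ta]) by [].
    case: (_ \in _) => /=; last by rewrite oppr0 expR0; lra.
    rewrite mulr1 addr0 expRN lef_pV2 ?posrE ?expR_gt0//.
    by have := expR_ge1Dx (1 : R); lra.
have mi : measurable_fun [set: T] (fun w => (\1_A w : R)%:E).
  by apply/measurable_EFinP; exact: measurable_indic.
have mic : measurable_fun [set: T] (fun w => (\1_(~` A) w : R)%:E).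
  by apply/measurable_EFinP; apply: measurable_indic; exact: measurableC.
have mi2 : measurable_fun [set: T] (fun w => (2^-1)%:E * (\1_A w : R)%:E)%E.
  exact: emeasurable_funM.
have i0 w : [set: T] w -> (0 <= (2^-1)%:E * (\1_A w : R)%:E)%E.
  by move=> _; rewrite -EFinM lee_fin mulr_ge0// indicE ler0n.
rewrite ge0_integralD// ge0_integralZl//.
rewrite !integral_indic// ?setIT//; last exact: measurableC.
have PCA : P (~` A) = (1 - ep)%:E by rewrite probability_setC// PA.
change ((2^-1)%:E * P A + P (~` A) <= (expR (- (ep / 2)))%:E)%E.
rewrite PCA PA -EFinM -EFinD lee_fin.
by apply: le_trans (expR_ge1Dx _); lra.
Qed.

Definition noise_index (ij : 'I_n * 'I_p) : I := inr ij.
Definition is_noise : pred I := fun k => if k is inr _ then true else false.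

Definition pattern (w : T) : {set 'I_p} * {set 'I_n} :=
  ([set j | mu j w == ta]%SET, [set i | ell i w == 1]%SET).

Definition sign_of (s : {set 'I_n}) (i : 'I_n) : R := if i \in s then 1 else -1.

Lemma normr_sign_of s i : `|sign_of s i| = 1.
Proof. by rewrite /sign_of; case: ifP => _; rewrite ?normrN normr1. Qed.

(** Prescribing the pattern constrains each sign and each entry of [mu] separately, to a point or to
    its complement, and leaves the noise free; hence fibers are independent of noise events. *)
Lemma pattern_cylinder k : cylinder F (predC is_noise) (pattern @^-1` [set k]).
Proof.
pose B0 (D : bool) (a : R) : set R := if D then [set a] else ~` [set a].
have mB0 D a : measurable (B0 D a).
  by rewrite /B0; case: D => //; exact: measurableC.
have B0E D a x : B0 D a x <-> (x == a) = D.
  by rewrite /B0; case: D => /=; split; case: eqP.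
exists (fun i : I => match i with
  | inl (inl i) => B0 (i \in k.2) 1
  | inl (inr j) => B0 (j \in k.1) ta
  | inr _ => setT end); split.
- by move=> [[i|j]|ij].
- by move=> [[i|j]|ij].
- apply/seteqP; split => w /=.
    by move=> <- [[i|j]|ij] _ //=; apply/B0E; rewrite inE.
  move=> h; rewrite /pattern [k]surjective_pairing; congr pair; apply/setP => x; rewrite inE.
    by have /B0E := h (inl (inr x)) Logic.I.
  by have /B0E := h (inl (inl x)) Logic.I.
Qed.

(** The columns summed may depend on the support of [mu] but not on the noise, so they are fixed on
    each fiber of [pattern]. *)
Variable Sel : {set 'I_p} -> {set 'I_p}.

Definition row_shift (A : {set 'I_p}) : R :=
  (Num.sqrt #|Sel A|%:R)^-1 * (ta * #|A :&: Sel A|%:R).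

Let noise_mean A i w := row_mean F noise_index (Sel A) i w.

Lemma rowstat_alt w i :
  (forall i, ell i w = 1 \/ ell i w = -1) -> (forall j, mu j w = ta \/ mu j w = 0) ->
  rowstat (Sel (pattern w).1) (X w) i =
    sign_of (pattern w).2 i * row_shift (pattern w).1 + noise_mean (pattern w).1 i w.
Proof.
move=> he hm; set A := (pattern w).1.
rewrite /rowstat /row_shift /noise_mean /row_mean mulrCA -mulrDr; congr (_ * _).
have -> : sign_of (pattern w).2 i = ell i w.
  by rewrite /sign_of inE; case: (he i) => ->; rewrite ?eqxx// eqNr oner_eq0.
have -> : ell i w * (ta * #|A :&: Sel A|%:R) = \sum_(j in Sel A) ell i w * mu j w.
  rewrite -mulr_sumr; congr (_ * _).
  rewrite -sum1_card natr_sum mulr_sumr big_mkcond [RHS]big_mkcond/=.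
  apply: eq_bigr => j _; rewrite finset.in_setI [j \in A]inE andbC.
  case: (j \in Sel A) => //=.
  by case: (hm j) => ->; rewrite ?eqxx ?mulr1// lt_eqF.
by rewrite -big_split/=; apply: eq_bigr => j _; rewrite XE mxE.
Qed.

(* Given the support of [mu] and the signs, the data are a deterministic shift of Gaussian noise. *)
Lemma alt_bound (Bad : 'M[R]_(n, p) -> bool) (g : R -> R) (thr c : R) :
  measurable_fun [set: R] g ->
  measurable [set w | Bad (X w)] ->
  (forall M A, Bad M -> \sum_i g (rowstat (Sel A) M i) <= thr) ->
  0 <= c ->
  (forall (A : {set 'I_p}) (sgn : 'I_n -> R), p%:R * ep / 4 < #|A|%:R -> (forall i, `|sgn i| = 1) ->
    (P [set w | \sum_i g (sgn i * row_shift A + noise_mean A i w) <= thr]%R <= c%:E)%E) ->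
  (P [set w | Bad (X w)] <= (expR (- (p%:R * ep / 4)) + c)%:E)%E.
Proof.
move=> mg mBad hBad c0 hc.
pose E (k : {set 'I_p} * {set 'I_n}) :=
  [set w | \sum_i g (sign_of k.2 i * row_shift k.1 + noise_mean k.1 i w) <= thr].
(* The bad event is covered by four pieces: null events where a sign ([U1]) or an entry of [mu]
   ([U2]) leaves its two values, a small support ([Sm]), and the fibers with large support met with
   their own Gaussian tail event ([V]). *)
pose U1 := \big[setU/set0]_(i : 'I_n) (ell i @^-1` ~` [set 1; -1]).
pose U2 := \big[setU/set0]_(j : 'I_p) (mu j @^-1` ~` [set ta; 0]).
pose Q (k : {set 'I_p} * {set 'I_n}) := p%:R * ep / 4 < #|k.1|%:R.
pose V := \big[setU/set0]_(k | Q k) (pattern @^-1` [set k] `&` E k).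
pose Sm := [set w | #|[set j | mu j w == ta]%SET|%:R <= p%:R * ep / 4].
have mc2 a b' : measurable (~` [set a; b'] : set R).
  by apply: measurableC; apply: measurableU.
have m1 i : measurable (ell i @^-1` ~` [set 1; -1]) by exact: measurable_funPTI.
have m2 j : measurable (mu j @^-1` ~` [set ta; 0]) by exact: measurable_funPTI.
have mU1 : measurable U1 by apply: bigsetU_measurable => i _.
have mU2 : measurable U2 by apply: bigsetU_measurable => i _.
have mpat k : measurable (pattern @^-1` [set k]).
  exact: cylinder_measurable (pattern_cylinder k).
have sE k : <<s cylinder F is_noise >> (E k).
  pose G w := \sum_i g (sign_of k.2 i * row_shift k.1 + noise_mean k.1 i w).
  have -> : E k = G @^-1` `]-oo, thr]%classic.
    by apply/seteqP; split => w /=; rewrite in_itv.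
  apply: (@depends_on_sigma _ _ _ P _ F) => //; apply: depends_on_sum => i _.
  apply: measurableT_comp => //; apply: measurable_funD => //.
  apply: (@depends_on_sub _ _ _ P _ F (row_indices noise_index i)).
    by move=> k' /existsP[j /eqP ->].
  exact: depends_on_row_mean.
have mE k : measurable (E k) by exact: sigma_cylinder_measurable (sE k).
have mV : measurable V by apply: bigsetU_measurable => k _; exact: measurableI.
have mSm : measurable Sm.
  (* [Sm] depends only on the pattern, so it is a finite union of measurable fibers. *)
  have -> : Sm = \big[setU/set0]_(k | ~~ Q k) (pattern @^-1` [set k]).
    rewrite -bigcup_seq_cond; apply/seteqP; split => w /=.
      by move=> h; exists (pattern w) => //=; rewrite mem_index_enum /Q -leNgt.
    by move=> [k /= /andP[_ h] kE]; move: h; rewrite -kE /Q -leNgt.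
  by apply: bigsetU_measurable => k _.
have P1 : (P U1 <= 0)%E.
  apply: le_trans (union_bound _ _ _) _ => //.
  by rewrite big1// => i _; exact: two_point_law_support (hell i).
have P2 : (P U2 <= 0)%E.
  apply: le_trans (union_bound _ _ _) _ => //.
  by rewrite big1// => i _; exact: two_point_law_support (hmu i).
have PV : (P V <= c%:E)%E.
  apply: conditioning_bound => // [k|k Qk].
    apply: (@indep_sigma _ _ _ P _ F indF (predC is_noise) is_noise) => //.
    by apply: sub_sigma_algebra; exact: pattern_cylinder.
  by apply: hc => // i; exact: normr_sign_of.
apply: (@le_trans _ _ (P ((U1 `|` U2) `|` (Sm `|` V)))).
  apply: probability_le_subset => //.
    by apply: measurableU; apply: measurableU.
  move=> w /= hw.
  have [h1|h1] := pselect (U1 w); first by left; left.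
  have [h2|h2] := pselect (U2 w); first by left; right.
  right; have [h3|h3] := pselect (Sm w); [by left|right].
  have he i : ell i w = 1 \/ ell i w = -1.
    apply: contrapT => h; apply: h1; rewrite /U1 -bigcup_seq; exists i => //=.
    exact: mem_index_enum.
  have hm j : mu j w = ta \/ mu j w = 0.
    apply: contrapT => h; apply: h2; rewrite /U2 -bigcup_seq; exists j => //=.
    exact: mem_index_enum.
  rewrite /V -bigcup_seq_cond; exists (pattern w).
    by rewrite /= mem_index_enum /Q ltNge; apply/negP.
  split => //; rewrite /E /=.
  apply: le_trans (hBad _ (pattern w).1 hw).
  rewrite le_eqVlt; apply/orP; left; apply/eqP.
  by apply: eq_bigr => i _; rewrite rowstat_alt.
apply: le_trans (measureU2 _ _ _) _; [exact: measurableU|exact: measurableU|].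
apply: (@le_trans _ _ (0 + (expR (- (p%:R * ep / 4)) + c)%:E)%E); last by rewrite add0e.
apply: leeD.
  apply: le_trans (measureU2 _ _ _) _ => //.
  by rewrite -[leRHS]adde0; exact: leeD.
apply: le_trans (measureU2 _ _ _) _ => //.
by rewrite EFinD; apply: leeD => //; exact: support_size_lower_tail.
Qed.
End AltModel.

(** * Type II errors of the two tests *)

Section AltTests.
Context {R : realType} {d : measure_display} {T : measurableType d}.
Variable P : probability T R.
Variables n p : nat.
Variables alpha beta : R.
Variable X : T -> 'M[R]_(n, p).
Hypothesis hX : ARW_model alpha beta P X.
Hypotheses (n_gt0 : (0 < n)%N) (p_gt1 : (1 < p)%N).
Local Notation L := (ln p%:R : R).
Local Notation ep := (eps beta p).
Local Notation ta := (tau alpha p).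

Let p_gt0 : (0 < p)%N. Proof. exact: ltnW. Qed.

Let L_gt0 : 0 < L. Proof. by rewrite ln_gt0// ltr1n. Qed.

Let ta_gt0 : 0 < ta. Proof. by rewrite powR_gt0// ltr0n. Qed.

Let ep_gt0 : 0 < ep. Proof. by rewrite powR_gt0// ltr0n. Qed.

(** A support of size at least [p ep / 4] gives [m^2 >= p (ta ep)^2 / 16]; the other factor 2 comes
    from [chi2_shift_lower_tail]. *)
Lemma alt_T_star : 4 * L <= n%:R ->
  (P [set w | ~~ T_star (X w)] <=
    (expR (- (p%:R * ep / 4)) +
     expR (6 * L - Num.sqrt (n%:R * L) * (p%:R * (ta * ep) ^+ 2 / 32)))%:E)%E.
Proof.
move=> hL; have [ell [mu [Z [indF hell hmu hZ XE]]]] := hX.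
pose Sel (A : {set 'I_p}) : {set 'I_p} := [set: 'I_p]%SET.
have Sel_gt0 A : (0 < #|Sel A|)%N by rewrite finset.cardsT card_ord.
have p0 : 0 < p%:R :> R by rewrite ltr0n.
have q0 : 0 <= Num.sqrt (n%:R * L) by exact: sqrtr_ge0.
apply: (@alt_bound _ _ _ P n p ep ta ell mu Z indF hell hmu X XE ta_gt0 Sel
  (fun M => ~~ T_star M) (fun x => x ^+ 2) (n%:R + 4 * Num.sqrt (n%:R * L))).
- exact: measurable_funX.
- have -> : [set w | ~~ T_star (X w)] = ~` [set w | T_star (X w)].
    by apply/seteqP; split => w /= /negP.
  apply: measurableC; apply: measurable_T_star => // i j.
  exact: measurable_alt_entry XE i j.
- by move=> M A; rewrite T_starE// -ltNge => /ltW.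
- exact: expR_ge0.
- move=> A sgn hA sgn1.
  have := @chi2_shift_lower_tail _ _ _ P _ _ indF n p (@noise_index n p).
  move=> /(_ _ hZ (Sel A) (Sel_gt0 A) n_gt0 sgn sgn1 L (row_shift ta Sel A) L_gt0 hL).
  move=> H; apply: le_trans (H _) _; first by move=> ij ij' [].
  rewrite lee_fin ler_expR lerD2l lerN2 -[leRHS]mulrA ler_wpM2l//.
  rewrite /row_shift /Sel finset.setIT finset.cardsT card_ord.
  rewrite [in leRHS]exprMn exprVn sqr_sqrtr ?ler0n//.
  have h : p%:R * (ta * ep) / 4 <= ta * #|A|%:R.
    by rewrite mulrCA -mulrA ler_pM2l// ltW.
  have h2 : (p%:R * (ta * ep) / 4) ^+ 2 <= (ta * #|A|%:R) ^+ 2.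
    by rewrite ler_pXn2r ?nnegrE// !mulr_ge0// ltW.
  have -> : p%:R * (ta * ep) ^+ 2 / 32 = p%:R^-1 * (p%:R * (ta * ep) / 4) ^+ 2 / 2.
    by field; rewrite gt_eqF.
  by rewrite ler_pM2r// ler_pM2l ?invr_gt0.
Qed.

(** Whichever of [N] and the support size is smaller, the overlap stays at least [p eps / 4]. *)
Lemma exists_selection (N : nat) (A : {set 'I_p}) : (N <= p)%N ->
  exists S : {set 'I_p}, (#|S| == N) && (minn N #|A| <= #|A :&: S|)%N.
Proof.
move=> Np; have [NA|AN] := leqP N #|A|.
  have /card_geqP[s [us ss sA]] := NA.
  have sA' : [set x in s]%SET \subset A.
    by apply/fintype.subsetP => x; rewrite inE => /sA.
  have cs : #|[set x in s]%SET| = N by rewrite cardsE (card_uniqP us).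
  by exists [set x in s]%SET; rewrite cs eqxx/= (finset.setIidPr sA') cs.
have : (N - #|A| <= #|~: A|)%N.
  by rewrite [leqRHS]cardsCs finset.setCK card_ord leq_sub2r.
move=> /card_geqP[s [us ss sA]].
have dis : A :&: [set x in s]%SET = finset.set0.
  apply/eqP; rewrite -finset.subset0; apply/fintype.subsetP => x.
  by rewrite !inE => /andP[xA /sA]; rewrite inE xA.
exists (A :|: [set x in s]%SET).
rewrite finset.cardsU dis finset.cards0 subn0 cardsE (card_uniqP us) ss.
rewrite subnKC ?(ltnW AN)// eqxx/=.
by apply: subset_leq_card; rewrite finset.subsetI fintype.subxx finset.subsetUl.
Qed.

(** The lower bound of [gauss_abs_shift_ge] for E |m + Y| - sqrt(2 / pi). *)
Definition sa_gap (m : R) : R := normal_pdf 0 1 1 / 2 * (m * Num.min m 1).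

Lemma alt_T_sa (N : nat) (Shat : 'M[R]_(n, p) -> {set 'I_p}) :
  (0 < N)%N -> (N <= p)%N -> p%:R * ep / 4 <= N%:R ->
  (forall M, sa_maximizer N M (Shat M)) ->
  let m0 := ta * (p%:R * ep / 4) / Num.sqrt N%:R in
  (40 + 32 * gauss_sqr_bound) * (N%:R + 2) * L <= n%:R * sa_gap m0 ^+ 2 ->
  128 * (1 + gauss_sqr_bound) * L <= n%:R * normal_pdf 0 1 1 ^+ 2 ->
  (P [set w | ~~ T_sa N Shat (X w)] <=
    (expR (- (p%:R * ep / 4)) + expR (- L))%:E)%E.
Proof.
move=> N0 Np Nep hS m0 H1 H2; have [ell [mu [Z [indF hell hmu hZ XE]]]] := hX.
pose Sel (A : {set 'I_p}) : {set 'I_p} := xchoose (exists_selection A Np).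
have SelP A : #|Sel A| = N /\ (minn N #|A| <= #|A :&: Sel A|)%N.
  by have /andP[/eqP] := xchooseP (exists_selection A Np).
have cSel A : #|Sel A| = N by have [] := SelP A.
have Sel_gt0 A : (0 < #|Sel A|)%N by rewrite cSel.
set h := Num.sqrt (2 * n%:R * ((N%:R + 2) * L)).
have n0 : 0 < n%:R :> R by rewrite ltr0n.
have N0' : 0 < N%:R :> R by rewrite ltr0n.
have p0 : 0 < p%:R :> R by rewrite ltr0n.
have C0 : 0 < gauss_sqr_bound :> R by rewrite /gauss_sqr_bound mulr_gt0// expR_gt0.
have c0 : 0 < normal_pdf 0 1 1 :> R.
  by rewrite normal_pdfE ?oner_eq0// mulr_gt0 ?normal_peak_gt0 ?oner_eq0 ?expR_gt0.
have m0_gt0 : 0 < m0 by rewrite divr_gt0 ?sqrtr_gt0// !mulr_gt0// invr_gt0.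
apply: (@alt_bound _ _ _ P n p ep ta ell mu Z indF hell hmu X XE ta_gt0 Sel
  (fun M => ~~ T_sa N Shat M) (fun x => `|x|)
  (Num.sqrt (2 / pi) * n%:R + h)).
- exact: measurableT_comp.
- have -> : [set w | ~~ T_sa N Shat (X w)] = ~` [set w | T_sa N Shat (X w)].
    by apply/seteqP; split => w /= /negP.
  apply: measurableC; apply: measurable_T_sa => // i j.
  exact: measurable_alt_entry XE i j.
- move=> M A; rewrite /T_sa -mulrA -ltNge => /ltW; apply: le_trans.
  by rewrite -(sa_statE M (cSel A)); have [_] := hS M; apply.
- exact: expR_ge0.
move=> A sgn hA sgn1; set m := row_shift ta Sel A.
have mm0 : m0 <= m.
  rewrite /m0 /m /row_shift cSel [leLHS]mulrC ler_pM2l ?invr_gt0 ?sqrtr_gt0//.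
  rewrite ler_pM2l//; apply: (@le_trans _ _ (minn N #|A|)%:R).
    by rewrite /minn; case: ifP => _ //; exact: ltW.
  by rewrite ler_nat; have [] := SelP A.
have m_gt0 : 0 < m by exact: lt_le_trans mm0.
have gap0 : 0 < sa_gap m0.
  have min0 : 0 < Num.min m0 1 by rewrite lt_min m0_gt0 ltr01.
  by apply: mulr_gt0; [exact: divr_gt0|exact: mulr_gt0].
have gap_le : sa_gap m0 <= sa_gap m.
  rewrite /sa_gap ler_pM2l ?divr_gt0//; apply: ler_pM => //.
  - exact: ltW.
  - by rewrite le_min (ltW m0_gt0) ler01.
  - by rewrite le_min !ge_min mm0 lexx orbT.
have gap2 : sa_gap m0 ^+ 2 <= sa_gap m ^+ 2.
  by rewrite ler_pXn2r ?nnegrE// ?(ltW gap0)// (le_trans (ltW gap0)).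
have NL : 0 < (N%:R + 2) * L by rewrite mulr_gt0// addr_gt0.
(* Squared, this is [8 (N + 2) L <= n * sa_gap m ^ 2], a consequence of [H1]. *)
have hh : h <= n%:R * sa_gap m / 2.
  have h0 : 0 <= n%:R * sa_gap m / 2.
    by rewrite divr_ge0// mulr_ge0 ?(ltW n0)// (le_trans (ltW gap0)).
  rewrite -(@ler_pXn2r _ 2) ?nnegrE// ?sqrtr_ge0// /h sqr_sqrtr; last first.
    by rewrite mulr_ge0 ?(ltW NL)// mulr_ge0// ltW.
  have -> : (n%:R * sa_gap m / 2) ^+ 2 = n%:R * (n%:R * sa_gap m ^+ 2) / 4.
    by field.
  have : 8 * ((N%:R + 2) * L) <= n%:R * sa_gap m ^+ 2.
    apply: (@le_trans _ _ (n%:R * sa_gap m0 ^+ 2)); last by rewrite ler_pM2l.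
    by apply: le_trans H1; rewrite -mulrA ler_pM2r//; lra.
  by move=> H; nra.
have := @abs_shift_lower_tail _ _ _ P _ _ indF n p (@noise_index n p).
move=> /(_ _ hZ (Sel A) (Sel_gt0 A) n_gt0 sgn sgn1 m h m_gt0 hh).
move=> H; apply: le_trans (H _) _; first by move=> ij ij' [].
rewrite lee_fin ler_expR lerN2 -/(sa_gap m).
rewrite ler_pdivlMr; last by rewrite mulr_gt0// addr_gt0// mulr_gt0// exprn_gt0.
(* For [m >= 1] numerator and denominator both grow like [m^2], so only [n] large against [log p]
   matters ([H2]). For [m < 1] the denominator is bounded and [H1] suffices. *)
have [m1|m1] := leP 1 m.
  rewrite /sa_gap (min_r m1) mulr1.
  have m2 : 1 <= m ^+ 2 by exact: exprn_ege1.
  have : (128 * (1 + gauss_sqr_bound) * L) * m ^+ 2 <= n%:R * normal_pdf 0 1 1 ^+ 2 * m ^+ 2.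
    by rewrite ler_wpM2r// sqr_ge0.
  have : gauss_sqr_bound * L <= gauss_sqr_bound * L * m ^+ 2.
    by rewrite ler_peMr// mulr_ge0 ?(ltW C0) ?(ltW L_gt0).
  lra.
have m2 : m ^+ 2 <= 1 by apply: exprn_ile1; exact: ltW.
have : m ^+ 2 * L <= L by rewrite ler_piMl// ltW.
have : n%:R * sa_gap m0 ^+ 2 <= n%:R * sa_gap m ^+ 2 by rewrite ler_pM2l.
have : (40 + 32 * gauss_sqr_bound) * 1 * L <= (40 + 32 * gauss_sqr_bound) * (N%:R + 2) * L.
  by rewrite ler_pM2r// ler_pM2l; [lra|rewrite addr_gt0// mulr_gt0].
by have := L_gt0; lra.
Qed.

End AltTests.

(** * Asymptotics *)

Section Asymptotics.
Context {R : realType}.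
Implicit Types (a K theta beta alpha : R).

Lemma near_ln_ge (M : R) : \forall p \near \oo, M <= ln p%:R.
Proof.
near=> p.
have h : expR M <= p%:R by near: p; exact: nbhs_infty_ger.
by rewrite -(expRK M) ler_ln// posrE ?expR_gt0// (lt_le_trans (expR_gt0 M)).
Unshelve. all: by end_near. Qed.

Lemma near_ln_le_powR a K : 0 < a -> \forall p \near \oo, K * ln p%:R <= p%:R `^ a.
Proof.
move=> a0; near=> p.
have L1 : 1 <= ln p%:R :> R by near: p; exact: near_ln_ge.
(* This makes the quadratic Taylor term [(a L)^2 / 2] of [exp(a L)] at least [K L]. *)
have LK : 2 * K / a ^+ 2 <= ln p%:R :> R by near: p; exact: near_ln_ge.
have p0 : 0 < p%:R :> R.
  by rewrite ltr0n lt0n; apply: contraTneq L1 => ->; rewrite ln0// -ltNge.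
rewrite /powR gt_eqF//; set L := ln _ in L1 LK *.
have aL : 0 <= a * L by rewrite mulr_ge0 ?ltW//; lra.
apply: le_trans (expR_ge1Dxn 1 aL); rewrite (_ : 2`! = 2)%N//.
move: LK; rewrite ler_pdivrMr ?exprn_gt0// => LK.
nra.
Unshelve. all: by end_near. Qed.

Lemma powR_gtr0D (x a b : R) : 0 < x -> x `^ (a + b) = x `^ a * x `^ b.
Proof. by move=> x0; rewrite powRD// (gt_eqF x0) implybT. Qed.

Lemma powR_sqr (x a : R) : 0 < x -> (x `^ a) ^+ 2 = x `^ (2 * a).
Proof. by move=> x0; rewrite expr2 -powR_gtr0D// -mulr2n mulr_natl. Qed.

Lemma cvg_of_near_bound (f : nat -> \bar R) (K : R) :
  (forall p, 0 <= f p)%E ->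
  (\forall p \near \oo, (f p <= (K * expR (- ln p%:R))%:E)%E) ->
  f @ \oo --> 0%E.
Proof.
move=> f0 hf.
have h : (fun p : nat => (K * p%:R^-1)%:E) @ \oo --> (0 : R)%:E.
  apply: cvg_EFin; first exact: nearW.
  rewrite -[X in _ --> X](mulr0 K); apply: cvgMr.
  apply/gtr0_cvgV0; last exact: cvgr_idn.
  by near=> p; rewrite ltr0n; near: p; exact: nbhs_infty_gt.
apply: (squeeze_cvge _ (cvg_cst 0%E) h).
near=> p; rewrite f0/=.
have p0 : (0 < p)%N by near: p; exact: nbhs_infty_gt.
have -> : p%:R^-1 = expR (- ln p%:R) :> R by rewrite expRN lnK// posrE ltr0n.
by near: p.
Unshelve. all: by end_near. Qed.

Section Sizes.
Variables (alpha beta theta : R) (p n : nat).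
Hypothesis p_gt0 : (0 < p)%N.
Local Notation x := (p%:R : R).

Let x_gt0 : 0 < x. Proof. by rewrite ltr0n. Qed.

Lemma mulp_eps : x * eps beta p = x `^ (1 - beta).
Proof. by rewrite -{1}(powRr1 (ltW x_gt0)) -powR_gtr0D. Qed.

Lemma N_sa_bounds : 0 <= beta ->
  [/\ (0 < N_sa beta p)%N, (N_sa beta p <= p)%N, x * eps beta p <= (N_sa beta p)%:R
    & (N_sa beta p)%:R <= x * eps beta p + 1].
Proof.
move=> b0; rewrite /N_sa; set y := x * _.
have y0 : 0 < y by rewrite mulr_gt0// powR_gt0.
have yx : y <= x.
  rewrite /y mulp_eps -[leRHS](powRr1 (ltW x_gt0)) ler_powR ?ler1n//; lra.
have cE : (`|Num.ceil y|%N)%:R = (Num.ceil y)%:~R :> R.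
  by rewrite natr_absz ger0_norm// ceil_ge0 (lt_trans _ y0)// ltrN10.
have h1 : y <= (`|Num.ceil y|%N)%:R by rewrite cE ceil_ge.
split => //.
- by rewrite -(ltr0n R) (lt_le_trans y0).
- by rewrite -(ler_nat R) cE -[x]/(p%:Z%:~R) ler_int ceil_le_int.
- by rewrite cE -lerBlDr; have := ltW (ceilB1_lt y); rewrite intrB.
Qed.

End Sizes.
End Asymptotics.

(** Three errors, each at most [1 / p]: null, small support, and Gaussian tail. The last needs
    [6 L - sqrt(n L) Q / 32 <= - L], hence [224 = 7 * 32], stated squared. *)
Lemma Err_T_star_le (R : realType) (d0 d1 : measure_display)
    (T0 : measurableType d0) (T1 : measurableType d1)
    (P0 : probability T0 R) (P1 : probability T1 R) (alpha beta : R) (n p : nat)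
    (X0 : T0 -> 'M[R]_(n, p)) (X1 : T1 -> 'M[R]_(n, p)) :
  null_model P0 X0 -> ARW_model alpha beta P1 X1 -> (0 < n)%N -> (1 < p)%N ->
  4 * ln p%:R <= n%:R :> R -> 4 * ln p%:R <= p%:R * eps beta p ->
  224 ^+ 2 * ln p%:R <= n%:R * (p%:R * (tau alpha p * eps beta p) ^+ 2) ^+ 2 ->
  (Err P0 P1 X0 X1 (@T_star R n p) <= (3 * expR (- ln p%:R))%:E)%E.
Proof.
move=> hX0 hX1 n0 p1 nL pL hQ; set L := ln p%:R in nL pL hQ *.
have L0 : 0 < L by rewrite ln_gt0// ltr1n.
have n0' : 0 < n%:R :> R by rewrite ltr0n.
set Q := p%:R * _ ^+ 2 in hQ.
have Q0 : 0 <= Q by rewrite mulr_ge0// sqr_ge0.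
have h : 224 * L <= Num.sqrt (n%:R * L) * Q.
  have hl : 0 <= 224 * L by lra.
  have hr : 0 <= Num.sqrt (n%:R * L) * Q by rewrite mulr_ge0// sqrtr_ge0.
  rewrite -(@ler_pXn2r _ 2)//.
  rewrite [leRHS]exprMn sqr_sqrtr; last by rewrite mulr_ge0// ltW.
  by have := ler_wpM2r (ltW L0) hQ; lra.
rewrite /Err (_ : 3 * expR (- L) = expR (- L) + (expR (- L) + expR (- L))); last by ring.
rewrite EFinD; apply: leeD; first exact: null_T_star.
apply: le_trans (alt_T_star hX1 n0 p1 nL) _.
rewrite lee_fin lerD// ler_expR -/L; first by lra.
rewrite -/Q; lra.
Qed.

(** With [y = p eps >= 1], rounding gives [N <= 2 y] and [N + 2 <= 4 y], so the squared shift is at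
    least [t^2 y / 32]. The last two hypotheses serve the shifts above and below 1, with
    [512 = 4 * 4 * 32] and [128^2 = 4 * 4 * 32^2]. *)
Lemma Err_T_sa_le (R : realType) (d0 d1 : measure_display)
    (T0 : measurableType d0) (T1 : measurableType d1)
    (P0 : probability T0 R) (P1 : probability T1 R) (alpha beta : R) (n p : nat)
    (X0 : T0 -> 'M[R]_(n, p)) (X1 : T1 -> 'M[R]_(n, p))
    (Shat : 'M[R]_(n, p) -> {set 'I_p}) :
  null_model P0 X0 -> ARW_model alpha beta P1 X1 -> (0 < n)%N -> (1 < p)%N ->
  0 < beta -> (forall M, sa_maximizer (N_sa beta p) M (Shat M)) ->
  let K := 40 + 32 * gauss_sqr_bound in
  let c := normal_pdf 0 1 1 ^+ 2 in
  1 <= p%:R * eps beta p -> 4 * ln p%:R <= p%:R * eps beta p ->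
  4 * K * ln p%:R <= n%:R * c ->
  512 * K * ln p%:R <= n%:R * c * tau alpha p ^+ 2 ->
  128 ^+ 2 * K * ln p%:R <= n%:R * c * (tau alpha p ^+ 4 * (p%:R * eps beta p)) ->
  (Err P0 P1 X0 X1 (T_sa (N_sa beta p) Shat) <= (3 * expR (- ln p%:R))%:E)%E.
Proof.
move=> hX0 hX1 n0 p1 b0 hS K c y1 pL H1 H2 H3.
have [N0 Np yN Ny] := N_sa_bounds (ltnW p1) (ltW b0).
set N := N_sa beta p in hS N0 Np yN Ny *.
set y := p%:R * eps beta p in y1 pL H3 yN Ny.
set t := tau alpha p in H2 H3.
set L := ln p%:R in pL H1 H2 H3 *.
have L0 : 0 < L by rewrite ln_gt0// ltr1n.
have t0 : 0 < t by rewrite powR_gt0// ltr0n ltnW.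
have n0' : 0 < n%:R :> R by rewrite ltr0n.
have N0' : 0 < N%:R :> R by rewrite ltr0n.
have C0 : 0 < gauss_sqr_bound :> R by rewrite /gauss_sqr_bound mulr_gt0// expR_gt0.
have K0 : 0 < K by rewrite /K; lra.
have c0 : 0 < c.
  by rewrite exprn_gt0// normal_pdfE ?oner_eq0// mulr_gt0 ?normal_peak_gt0 ?oner_eq0 ?expR_gt0.
rewrite /Err (_ : 3 * expR (- L) = expR (- L) + (expR (- L) + expR (- L))); last by ring.
rewrite EFinD; apply: leeD; first exact: null_T_sa.
have y4 : y / 4 <= N%:R by lra.
have KL0 : 0 < K * L by rewrite mulr_gt0.
apply: le_trans (alt_T_sa hX1 n0 p1 N0 Np y4 hS _ _) _; last first.
  by rewrite lee_fin lerD// ler_expR -/y -/L; lra.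
- rewrite -/L -/c; apply: le_trans H1.
  by rewrite /K; have := mulr_gt0 C0 L0; lra.
rewrite -/y -/t -/L -/K.
set m := t * (y / 4) / Num.sqrt N%:R.
have y40 : 0 < y / 4 by lra.
have m0 : 0 < m by apply: divr_gt0; [exact: mulr_gt0|rewrite sqrtr_gt0].
set u := m ^+ 2.
have uE : u = t ^+ 2 * y ^+ 2 / (16 * N%:R).
  by rewrite /u /m expr_div_n sqr_sqrtr ?(ltW N0')//; field; rewrite gt_eqF.
have ul : t ^+ 2 * y / 32 <= u.
  rewrite uE ler_pdivlMr; last by rewrite mulr_gt0.
  have -> : t ^+ 2 * y / 32 * (16 * N%:R) = t ^+ 2 * y / 2 * N%:R by field.
  have -> : t ^+ 2 * y ^+ 2 = t ^+ 2 * y / 2 * (2 * y) by field.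
  apply: ler_wpM2l; last by lra.
  by rewrite divr_ge0// mulr_ge0 ?sqr_ge0//; lra.
have l0 : 0 <= t ^+ 2 * y / 32 by rewrite divr_ge0// mulr_ge0 ?sqr_ge0//; lra.
have gE : sa_gap m ^+ 2 = c / 4 * (u * Num.min m 1 ^+ 2).
  by rewrite /sa_gap /c /u; field.
have N4 : N%:R + 2 <= 4 * y by lra.
apply: (@le_trans _ _ (K * (4 * y) * L)).
  by rewrite ler_pM2r// ler_pM2l.
rewrite gE; have [m1|m1] := leP 1 m.
  rewrite expr1n mulr1.
  apply: (@le_trans _ _ (n%:R * (c / 4 * (t ^+ 2 * y / 32)))); last first.
    by rewrite ler_pM2l// ler_pM2l// divr_gt0.
  have := ler_wpM2r (le_trans ler01 y1) H2; lra.
rewrite -/u.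
apply: (@le_trans _ _ (n%:R * (c / 4 * ((t ^+ 2 * y / 32) * (t ^+ 2 * y / 32))))); last first.
  by rewrite ler_pM2l// ler_pM2l ?divr_gt0//; exact: ler_pM.
have := ler_wpM2r (le_trans ler01 y1) H3; lra.
Qed.

(* [p ^ theta] need not be an integer: [n p] is any rounding of it, and is
   [p ^ theta] itself when that is an integer. *)
Theorem theorem4p2 (R : realType) (alpha beta theta : R)
    (halpha : 0 < alpha < 1) (hbeta : 0 < beta < 1) (htheta : 0 < theta < 1)
    (heta : alpha < eta_hyp theta beta)
    (n : nat -> nat)
    (hn : forall p : nat, `|(n p)%:R - p%:R `^ theta| < 1)
    (d0 d1 : nat -> measure_display)
    (T0 : forall p : nat, measurableType (d0 p))
    (T1 : forall p : nat, measurableType (d1 p))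
    (P0 : forall p : nat, probability (T0 p) R)
    (P1 : forall p : nat, probability (T1 p) R)
    (X0 : forall p : nat, T0 p -> 'M[R]_(n p, p))
    (X1 : forall p : nat, T1 p -> 'M[R]_(n p, p))
    (hX0 : forall p : nat, null_model (P0 p) (X0 p))
    (hX1 : forall p : nat, ARW_model alpha beta (P1 p) (X1 p)) :
  (alpha < eta_hyp1 theta beta ->
     (fun p : nat => Err (P0 p) (P1 p) (X0 p) (X1 p) (@T_star R (n p) p))
       @ \oo --> 0%E)
  /\
  (alpha < eta_hyp2 theta beta ->
   forall Shat : forall p : nat, 'M[R]_(n p, p) -> {set 'I_p},
     (forall (p : nat) (X : 'M[R]_(n p, p)),
        sa_maximizer (N_sa beta p) X (Shat p X)) ->
     (fun p : nat => Err (P0 p) (P1 p) (X0 p) (X1 p)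
                         (T_sa (N_sa beta p) (Shat p)))
       @ \oo --> 0%E).
Proof.
move: halpha hbeta htheta => /andP[a0 a1] /andP[b0 b1] /andP[t0 t1].
(* The rounding error is below 1, hence at most half of [p^theta] once [p^theta >= 2]. *)
have n_ge : \forall p \near \oo, p%:R `^ theta / 2 <= (n p)%:R.
  near=> p.
  have L1 : 1 <= ln p%:R :> R by near: p; exact: near_ln_ge.
  have h : 2 * ln p%:R <= p%:R `^ theta by near: p; exact: near_ln_le_powR.
  by have := hn p; rewrite ltr_norml => /andP[]; lra.
have p_gt1 : \forall p \near \oo, (1 < p)%N by exact: nbhs_infty_gt.
have eps_ge (K : R) : \forall p \near \oo, K * ln p%:R <= p%:R * eps beta p.
  near=> p.
  have p0 : (0 < p)%N by apply: ltnW; near: p.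
  rewrite mulp_eps//; near: p; apply: near_ln_le_powR; lra.
split.
  rewrite /eta_hyp1 => h; apply: (@cvg_of_near_bound _ _ 3) => [p|].
    by rewrite adde_ge0.
  near=> p.
  have p1 : (1 < p)%N by near: p.
  have p0 : 0 < p%:R :> R by rewrite ltr0n ltnW.
  have L0 : 0 < ln p%:R :> R by rewrite ln_gt0// ltr1n.
  have np : p%:R `^ theta / 2 <= (n p)%:R by near: p.
  have hL : 8 * ln p%:R <= p%:R `^ theta by near: p; exact: near_ln_le_powR.
  apply: (@Err_T_star_le _ _ _ _ _ _ _ alpha beta) => //.
  - by rewrite -(ltr0n R); lra.
  - by lra.
  - by near: p; exact: eps_ge.
  (* The exponent of [n (p (tau eps)^2)^2]; it is positive exactly when
     [alpha < eta_hyp1 theta beta]. *)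
  set r := theta + 2 * (1 + 2 * (- alpha - beta)).
  have hr : 2 * 224 ^+ 2 * ln p%:R <= p%:R `^ r.
    near: p; apply: near_ln_le_powR; rewrite /r; lra.
  have -> : (p%:R * (tau alpha p * eps beta p) ^+ 2) ^+ 2 =
      p%:R `^ (2 * (1 + 2 * (- alpha - beta))).
    rewrite /tau /eps -powR_gtr0D// powR_sqr//.
    by rewrite -{1}(powRr1 (ltW p0)) -powR_gtr0D// powR_sqr.
  move: hr; rewrite /r powR_gtr0D//; set z := _ `^ (2 * _) => hr.
  have z0 : 0 <= z by exact: powR_ge0.
  by have := ler_wpM2r z0 np; lra.
rewrite /eta_hyp2 lt_min => /andP[h1 h2] Shat hS.
apply: (@cvg_of_near_bound _ _ 3) => [p|]; first by rewrite adde_ge0.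
pose K : R := 40 + 32 * gauss_sqr_bound.
pose c : R := normal_pdf 0 1 1 ^+ 2.
have c0 : 0 < c.
  by rewrite exprn_gt0// normal_pdfE ?oner_eq0// mulr_gt0 ?normal_peak_gt0 ?oner_eq0 ?expR_gt0.
have near_c (A a : R) : 0 < a -> \forall p \near \oo, A * ln p%:R <= c * p%:R `^ a.
  move=> a_gt0; near=> p.
  have h : (A / c) * ln p%:R <= p%:R `^ a by near: p; exact: near_ln_le_powR.
  by move: (ler_wpM2l (ltW c0) h); rewrite mulrA mulrCA divff ?mulr1 ?gt_eqF.
near=> p.
have p1 : (1 < p)%N by near: p.
have p0 : 0 < p%:R :> R by rewrite ltr0n ltnW.
have L0 : 0 < ln p%:R :> R by rewrite ln_gt0// ltr1n.
have L1 : 1 <= ln p%:R :> R by near: p; exact: near_ln_ge.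
have np : p%:R `^ theta / 2 <= (n p)%:R by near: p.
have hL : 8 * ln p%:R <= p%:R `^ theta by near: p; exact: near_ln_le_powR.
have peps : 4 * ln p%:R <= p%:R * eps beta p by near: p; exact: eps_ge.
apply: (@Err_T_sa_le _ _ _ _ _ _ _ alpha beta) => //; rewrite -/K -/c.
- by rewrite -(ltr0n R); lra.
- by lra.
- have h : 8 * K * ln p%:R <= c * p%:R `^ theta by near: p; exact: near_c.
  by have := ler_wpM2l (ltW c0) np; lra.
(* The exponent [theta - 2 alpha] is positive by the first bound in the minimum. *)
- have h : 1024 * K * ln p%:R <= c * p%:R `^ (theta + 2 * - alpha).
    by near: p; apply: near_c; lra.
  move: h; rewrite powR_gtr0D// /tau powR_sqr//; set z := _ `^ (2 * _) => h.
  have cz : 0 <= c * z by rewrite mulr_ge0 ?powR_ge0// ltW.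
  by have := ler_wpM2l cz np; lra.
(* The exponent [theta - 4 alpha + 1 - beta] is positive by the second bound in the minimum. *)
- have h : 2 * 128 ^+ 2 * K * ln p%:R <=
      c * p%:R `^ (theta + (2 * (2 * - alpha) + (1 - beta))).
    by near: p; apply: near_c; lra.
  move: h; rewrite powR_gtr0D// powR_gtr0D// -(mulp_eps _ (ltnW p1)).
  rewrite -!powR_sqr// -exprM -/(tau alpha p) => h.
  have cz : 0 <= c * (tau alpha p ^+ 4 * (p%:R * eps beta p)).
    apply: mulr_ge0; first exact: ltW.
    by apply: mulr_ge0; [exact/exprn_ge0/powR_ge0|rewrite mulr_ge0// powR_ge0].
  by have := ler_wpM2l cz np; lra.
Unshelve. all: by end_near. Qed.
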